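(* Let $\mathbb{S}^{n}_{++}\cap\mathbb{V}$ be a sparse spectrahedral cone of order $n$. If $\mathbb{S}^{n}_{++}\cap\mathbb{V}$ is a homogeneous convex cone, then its rank and the Carathéodory number of its closure $\mathbb{S}^{n}_{+}\cap\mathbb{V}$ are both equal to $n$.
   Context: $\mathbb{S}^n$ is the space of real symmetric $n\times n$ matrices; $\mathbb{S}^n_{++}$ and $\mathbb{S}^n_+$ are the cones of positive definite and positive semidefinite matrices in it. A sparse spectrahedral cone of order $n$ is a cone $\mathbb{S}^n_{++}\cap\mathbb{V}$ where, for some simple undirected graph $G=(V,E)$ with vertex set $V=\{1,\dots,n\}$, $\mathbb{V}=\{X\in\mathbb{S}^n\mid X_{ij}=0 \text{ for all } i\ne j \text{ with } \{i,j\}\notin E\}$. A homogeneous convex cone is a convex cone $\mathsf{K}$ in a finite-dimensional real vector space that is pointed (contains no line), relatively open, and on which the group of linear automorphisms of its linear span mapping $\mathsf{K}$ onto itself acts transitively. A face of a closed convex cone $\bar{\mathsf{C}}$ is a nonempty convex subset containing both endpoints of every open line segment in $\bar{\mathsf{C}}$ that it meets; an extreme ray is a one-dimensional face. For a closed pointed convex cone $\bar{\mathsf{C}}$ and $x\in\bar{\mathsf{C}}$, $\kappa_{\bar{\mathsf{C}}}(x)$ is the least number of extreme rays of $\bar{\mathsf{C}}$ whose Minkowski sum contains $x$; the Carathéodory number of $\bar{\mathsf{C}}$ is $\max_{x\in\bar{\mathsf{C}}}\kappa_{\bar{\mathsf{C}}}(x)$. Rank: the rank of a homogeneous convex cone $\mathsf{K}$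 (Vinberg) is the dimension of a maximal connected commutative group of its automorphisms consisting of semisimple transformations with real eigenvalues; equivalently, it is the length $l$ of any maximal chain $\bar{\mathsf{K}}=\mathsf{F}(1)\supsetneq\dots\supsetneq\mathsf{F}(l)\ne\{0\}$ of nonzero faces of its closure. *)

(* Defs.v *)
From HB Require Import structures.
From mathcomp Require Import all_boot all_order all_algebra.
From mathcomp Require Import all_classical all_reals all_analysis.

Set Implicit Arguments.
Unset Strict Implicit.
Unset Printing Implicit Defensive.

Import Order.TTheory GRing.Theory Num.Theory.
Import numFieldNormedType.Exports.

Local Open Scope classical_set_scope.
Local Open Scope ring_scope.

Section Span.
Variables (R : realType) (E : vectType R).

Definition is_linspan (A : set E) (L : {vspace E}) : Prop :=
  (forall x, A x -> x \in L) /\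
  (forall M : {vspace E}, (forall x, A x -> x \in M) -> (L <= M)%VS).

Lemma is_linspan_ex (A : set E) : exists L, is_linspan A L.
Proof.
pose P d := `[< exists2 L : {vspace E}, (forall x, A x -> x \in L) & \dim L = d >].
have Pex : exists d, P d.
  by exists (\dim {:E}); apply/asboolP; exists fullv => // x _; rewrite memvf.
case: (ex_minnP Pex) => d /asboolP[L AL dL] dmin.
exists L; split=> // M AM; apply/capv_idPl/eqP.
rewrite eqEdim capvSl dL dmin//; apply/asboolP.
by exists (L :&: M)%VS => // x Ax; rewrite memv_cap AL// AM.
Qed.

Definition linspan (A : set E) : {vspace E} := xget 0%VS (is_linspan A).

Lemma linspanP (A : set E) : is_linspan A (linspan A).
Proof. by have [L AL] := is_linspan_ex A; exact: (xgetPex 0%VS (ex_intro _ L AL)). Qed.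

(* The set A, seen as a subset of its own linear span. *)
Definition in_span (A : set E) : set (subvs_of (linspan A)) :=
  [set u | A (vsval u)].

End Span.
Arguments in_span {R E} A.

Section Groups.
Variables (R : realType) (E : vectType R).
Implicit Types (C : set E) (G H : set 'End(E)).

Definition cone_aut C : set 'End(E) :=
  [set g | lker g = 0%VS /\ g @` C = C].

Definition is_group G : Prop :=
  [/\ G \1%VF,
      forall g h, G g -> G h -> G (g \o h)%VF &
      forall g, G g -> G (g^-1)%VF].

Definition commutative_group G : Prop :=
  forall g h, G g -> G h -> (g \o h = h \o g)%VF.

(* The topology of 'End(E) is that of the coordinate matrices. *)
Definition connected_group G : Prop :=
  connected (VectorInternalTheory.f2mx @` G).

(* Semisimple with real eigenvalues: E has a basis of eigenvectors over R. *)
Definition real_semisimple (g : 'End(E)) : Prop :=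
  exists2 b : seq E, basis_of {:E} b
    & forall v, v \in b -> exists a : R, g v = a *: v.

(* The Lie algebra of G: the infinitesimal generators of the one-parameter    *)
(* subgroups of G, i.e. the X such that exp(tX) is in G for all t.            *)
Definition lie_algebra G : set 'End(E) :=
  [set X | exists phi : R -> 'End(E),
    [/\ forall t, G (phi t),
        phi 0 = \1%VF,
        forall s t, phi (s + t) = (phi s \o phi t)%VF &
        forall i j, is_derive (0 : R) (1 : R)
          (fun t => VectorInternalTheory.f2mx (phi t) i j)
          (VectorInternalTheory.f2mx X i j)]].

Definition group_dim G (d : nat) : Prop :=
  exists2 U : {vspace 'End(E)}, (forall X, X \in U <-> lie_algebra G X)
    & \dim U = d.

Definition split_torus C G : Prop :=
  [/\ G `<=` cone_aut C, is_group G, commutative_group G, connected_group G &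
      forall g, G g -> real_semisimple g].

Definition maximal_split_torus C G : Prop :=
  split_torus C G /\ (forall H, split_torus C H -> G `<=` H -> H = G).

End Groups.

Section Faces.
Variables (R : realType) (E : vectType R).
Implicit Types (C F : set E).

Definition face C F : Prop :=
  [/\ F !=set0, F `<=` C, convex_set F &
      forall (x y : E) (t : R), C x -> C y -> 0 < t < 1 ->
        F (t *: x + (1 - t) *: y) -> F x /\ F y].

(* A face of a cone contains 0, so its dimension is that of its linear span. *)
Definition extreme_ray C F : Prop := face C F /\ \dim (linspan F) = 1%N.

Definition nonzero_face C F : Prop := face C F /\ F <> [set 0].

Definition face_chain C (l : nat) (F : 'I_l -> set E) : Prop :=
  (forall i, nonzero_face C (F i)) /\
  (forall i j : 'I_l, (i < j)%N -> F j `<` F i).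

(* No nonzero face can be added to the chain; since C is a nonzero face of    *)
(* itself (unless C = {0}), such a chain starts with C.                       *)
Definition maximal_face_chain C (l : nat) (F : 'I_l -> set E) : Prop :=
  face_chain C F /\
  (forall F', nonzero_face C F' ->
     (forall i, F' `<=` F i \/ F i `<=` F') -> exists i, F' = F i).

Definition sum_of_rays C (x : E) (k : nat) : Prop :=
  exists (F : 'I_k -> set E) (y : 'I_k -> E),
    [/\ forall i, extreme_ray C (F i), forall i, F i (y i)
      & x = \sum_(i < k) y i].

Definition kappa_eq C (x : E) (k : nat) : Prop :=
  sum_of_rays C x k /\ (forall m, sum_of_rays C x m -> (k <= m)%N).

Definition caratheodory_number_eq C (N : nat) : Prop :=
  (exists2 x, C x & kappa_eq C x N) /\
  (forall x, C x -> exists2 k, kappa_eq C x k & (k <= N)%N).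

End Faces.

Section Cones.
Variables (R : realType) (n : nat).
Implicit Types (K : set 'M[R]_n) (X : 'M[R]_n) (e : rel 'I_n).

Definition convex_cone K : Prop :=
  convex_set K /\ (forall (t : R) X, 0 < t -> K X -> K (t *: X)).

Definition pointed K : Prop :=
  ~ exists X V : 'M[R]_n, V != 0 /\ (forall t : R, K (X + t *: V)).

Definition relatively_open K : Prop :=
  exists2 U : set 'M[R]_n, open U
    & K = U `&` [set X | X \in linspan K].

Definition homogeneous_cone K : Prop :=
  [/\ convex_cone K, pointed K, relatively_open K &
      forall x y, in_span K x -> in_span K y ->
        exists2 g, cone_aut (in_span K) g & g x = y].

(* Vinberg's rank. That it does not depend on the choice of G is a theorem. *)
Definition torus_rank_eq K (r : nat) : Prop :=
  exists2 G, maximal_split_torus (in_span K) G & group_dim G r.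

(* The rank as the common length of all maximal chains of nonzero faces. *)
Definition chain_rank_eq K (r : nat) : Prop :=
  (exists F : 'I_r -> set 'M[R]_n, maximal_face_chain (closure K) F) /\
  (forall (l : nat) (F : 'I_l -> set 'M[R]_n),
     maximal_face_chain (closure K) F -> l = r).

Definition posdef X : Prop :=
  X^T = X /\ (forall u : 'cV[R]_n, u != 0 -> 0 < (u^T *m X *m u) 0 0).

Definition possemidef X : Prop :=
  X^T = X /\ (forall u : 'cV[R]_n, 0 <= (u^T *m X *m u) 0 0).

Definition sparse e X : Prop :=
  X^T = X /\ (forall i j, i != j -> ~~ e i j -> X i j = 0).

Definition sparse_cone e : set 'M[R]_n := [set X | posdef X /\ sparse e X].

Definition closed_sparse_cone e : set 'M[R]_n :=
  [set X | possemidef X /\ sparse e X].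

End Cones.
Arguments sparse_cone R {n} e.
Arguments closed_sparse_cone R {n} e.

(* Main.v *)
Require Import Defs.
From HB Require Import structures.
From mathcomp Require Import all_boot all_order all_algebra.
From mathcomp Require Import all_classical all_reals all_analysis.
From mathcomp Require Import ring lra.

Set Implicit Arguments.
Unset Strict Implicit.
Unset Printing Implicit Defensive.
Import Order.TTheory GRing.Theory Num.Theory.
Import numFieldNormedType.Exports.
Local Open Scope classical_set_scope.
Local Open Scope ring_scope.

(**
  Let g be an automorphism of the cone with g 1 = X, and put B_i := g E_ii. The
  B_i are positive semidefinite with sum X, and since the sum of the E_jj
  (j != i) is not positive definite, neither is that of the B_j (j != i), which
  therefore kills a vector u_i. The u_i form a basis and B_i kills all of it
  but u_i, so X is a sum of n sparse rank-one matrices; by compactness this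
  extends to the closed cone. Hence extreme rays consist of matrices of rank at
  most one, which gives the Caratheodory number. A face is the set of matrices
  of the closed cone whose row space lies in that of a given one, and adding a
  rank-one matrix to it raises the rank by one, which gives the length of
  maximal chains of faces.

  For the torus rank, the positive diagonal congruences X |-> D X D act on the
  span with one-dimensional weight spaces, so whatever commutes with them is
  an entrywise multiplier c; preserving the cone forces c_kl^2 = c_kk c_ll, and
  connectedness forces c_kl > 0, so that the multiplier is again a congruence.
*)

(** * Quadratic forms *)

Section QuadraticForms.
Variables (R : realType) (n : nat).
Implicit Types (X Y : 'M[R]_n) (u v w : 'cV[R]_n).

Definition qform X u : R := (u^T *m X *m u) 0 0.

Lemma qformD X Y u : qform (X + Y) u = qform X u + qform Y u.
Proof. by rewrite /qform mulmxDr mulmxDl mxE. Qed.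

Lemma qformZ (a : R) X u : qform (a *: X) u = a * qform X u.
Proof. by rewrite /qform -scalemxAr -scalemxAl mxE. Qed.

Lemma qform_sum (I : finType) (P : pred I) (F : I -> 'M[R]_n) u :
  qform (\sum_(i | P i) F i) u = \sum_(i | P i) qform (F i) u.
Proof. by rewrite /qform mulmx_sumr mulmx_suml summxE. Qed.

Lemma qform_outer v u : qform (v *m v^T) u = ((v^T *m u) 0 0) ^+ 2.
Proof.
rewrite /qform mulmxA -mulmxA mxE big_ord1 expr2; congr (_ * _).
by rewrite -[v in LHS]trmxK -trmx_mul mxE.
Qed.

Lemma sqnorm_gt0 u : u != 0 -> 0 < (u^T *m u) 0 0.
Proof.
move=> u0; rewrite mxE lt_neqAle eq_sym psumr_neq0; last first.
  by move=> i _; rewrite mxE -expr2 sqr_ge0.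
rewrite sumr_ge0 ?andbT; last by move=> i _; rewrite mxE -expr2 sqr_ge0.
have /cV0Pn[i ui] := u0; apply/hasP; exists i; first exact: mem_index_enum.
by rewrite /= mxE -expr2 lt_neqAle sqr_ge0 eq_sym sqrf_eq0 ui.
Qed.

Lemma qform1 u : qform 1%:M u = (u^T *m u) 0 0.
Proof. by rewrite /qform mulmx1. Qed.

Lemma qformDv X u w : X^T = X ->
  qform X (u + w) = qform X u + 2 * (w^T *m X *m u) 0 0 + qform X w.
Proof.
move=> sX; rewrite /qform [(u + w)^T]linearD /= !mulmxDl !mulmxDr.
have addE (A B : 'M[R]_1) : (A + B) 0 0 = A 0 0 + B 0 0 by rewrite mxE.
rewrite !addE.
have -> : (u^T *m X *m w) 0 0 = (w^T *m X *m u) 0 0.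
  rewrite -[u^T *m X *m w]trmxK [LHS]mxE !trmx_mul trmxK sX.
  by rewrite mulmxA.
ring.
Qed.

Lemma qformZv X (a : R) u : qform X (a *: u) = a ^+ 2 * qform X u.
Proof.
rewrite /qform [(a *: u)^T]linearZ /= -!scalemxAl -scalemxAr.
by rewrite [LHS]mxE [X in _ * X]mxE mulrA -expr2.
Qed.

(** If [X *m u] were nonzero, moving [u] slightly in the direction of [- X *m u] would make the form
    negative. *)
Lemma possemidef_ker X u : possemidef X -> qform X u = 0 -> X *m u = 0.
Proof.
move=> [sX pX] qu; apply/eqP/negP => /negP /sqnorm_gt0.
set w := X *m u; set b := (w^T *m w) 0 0 => b0.
have c0 : 0 <= qform X w := pX w.
(* With [w = X *m u], [b = w^T w] and [c] the form at [w], the form at [u + t w] is [2 t b + t^2 c].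
   At [t = - b / (c + 1)] this is negative; the [+ 1] keeps the denominator positive when
   [c = 0]. *)
have := pX (u + (- b / (qform X w + 1)) *: w).
rewrite -[X in _ <= X]/(qform X _) qformDv// qu qformZv.
rewrite [(_ *: w)^T]linearZ /= -mulmxA -scalemxAl [X in 2 * X]mxE -/w -/b.
set c := qform X w in c0 *; have c1 : c + 1 != 0 by rewrite gt_eqF// ltr_wpDl.
suff : 0 + 2 * (- b / (c + 1) * b) + (- b / (c + 1)) ^+ 2 * c < 0.
  by move=> /lt_le_trans h /h; rewrite ltxx.
have -> : 0 + 2 * (- b / (c + 1) * b) + (- b / (c + 1)) ^+ 2 * c =
  - (b / (c + 1)) ^+ 2 * (c + 2) by field.
rewrite mulNr oppr_lt0 mulr_gt0//; last by rewrite ltr_wpDl.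
by rewrite exprn_gt0// divr_gt0// ltr_wpDl.
Qed.

(** Cauchy-Schwarz for a degenerate form. If the form vanishes at [w], then [X] kills [w] and both
    sides are zero; otherwise the form is evaluated at its minimum on the line through [u] in
    direction [w]. *)
Lemma possemidef_CS X u w : possemidef X ->
  ((w^T *m X *m u) 0 0) ^+ 2 <= qform X w * qform X u.
Proof.
move=> pX; have [sX qX] := pX; set b := (_ 0 0).
have := qX w; rewrite -[X in _ <= X]/(qform X w) le_eqVlt => /predU1P[/esym q0|q0].
  have : X *m w = 0 by exact: possemidef_ker.
  rewrite q0 mul0r /b => /(congr1 trmx); rewrite trmx_mul sX trmx0 => ->.
  by rewrite mul0mx mxE expr0n.
have := qX (u + (- b / qform X w) *: w).
rewrite -[X in _ <= X]/(qform X _) qformDv// qformZv [(_ *: w)^T]linearZ /=.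
rewrite -!scalemxAl [X in 2 * X]mxE -/b.
set c := qform X w in q0 *; set d := qform X u.
have c1 : c != 0 by rewrite gt_eqF.
have -> : d + 2 * (- b / c * b) + (- b / c) ^+ 2 * c = (c * d - b ^+ 2) / c by field.
by rewrite pmulr_lge0 ?invr_gt0// subr_ge0.
Qed.

Lemma posdef_semidef X : posdef X -> possemidef X.
Proof.
move=> [sX pX]; split=> // u; have [->|/pX/ltW//] := eqVneq u 0.
by rewrite mulmx0 mxE.
Qed.

Lemma posdef1 : posdef (1%:M : 'M[R]_n).
Proof.
split=> [|u u0]; first exact: trmx1.
by rewrite -/(qform _ _) qform1 sqnorm_gt0.
Qed.

Lemma possemidefD X Y : possemidef X -> possemidef Y -> possemidef (X + Y).
Proof.
move=> [sX pX] [sY pY]; split=> [|u]; first by rewrite raddfD /= sX sY.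
by rewrite -/(qform _ _) qformD addr_ge0// ?pX ?pY.
Qed.

Lemma possemidefZ (a : R) X : 0 <= a -> possemidef X -> possemidef (a *: X).
Proof.
move=> a0 [sX pX]; split=> [|u]; first by rewrite linearZ /= sX.
by rewrite -/(qform _ _) qformZ mulr_ge0// pX.
Qed.

Lemma possemidef0 : possemidef (0 : 'M[R]_n).
Proof. by split=> [|u]; rewrite ?trmx0// mulmx0 mul0mx mxE. Qed.

Lemma possemidef_sum (I : finType) (P : pred I) (F : I -> 'M[R]_n) :
  (forall i, P i -> possemidef (F i)) -> possemidef (\sum_(i | P i) F i).
Proof. by move=> pF; elim/big_ind: _ => //; [exact: possemidef0|exact: possemidefD]. Qed.

Lemma possemidef_outer v : possemidef (v *m v^T).
Proof.
split=> [|u]; first by rewrite trmx_mul trmxK.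
by rewrite -/(qform _ _) qform_outer sqr_ge0.
Qed.

Lemma possemidef_addeps (eps : R) X :
  0 < eps -> possemidef X -> posdef (X + eps *: 1%:M).
Proof.
move=> e0 [sX pX]; split=> [|u u0].
  by rewrite raddfD /= sX linearZ /= trmx1.
rewrite -/(qform _ _) qformD qformZ qform1 ltr_wpDl//; first exact: pX.
by rewrite mulr_gt0// sqnorm_gt0.
Qed.

Lemma delta_outer (i : 'I_n) :
  delta_mx i i = delta_mx i 0 *m (delta_mx i 0 : 'cV[R]_n)^T :> 'M[R]_n.
Proof. by rewrite trmx_delta mul_delta_mx. Qed.

(** Write [v = X *m w] and let [c] be the form at [w]. By Cauchy-Schwarz the square of [v^T u] is at
    most [c] times the form at [u], so every [eps] up to [1 / c] works; [1 / (c + 2)] is moreover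
    below 1, as a proper convex weight must be. *)
Lemma possemidef_sub_outer X v : possemidef X -> (v^T <= X)%MS ->
  exists2 eps : R, 0 < eps < 1 & possemidef (X - eps *: (v *m v^T)).
Proof.
move=> pX /submxP[w0 vE]; have [sX qX] := pX.
pose w := w0^T.
have vE' : v = X *m w by rewrite -[v]trmxK vE trmx_mul sX.
pose c := qform X w; have c0 : 0 <= c := qX w.
exists ((c + 2)^-1).
  have c2 : 0 < c + 2 by lra.
  by rewrite invr_gt0 c2 invf_lt1//=; lra.
split=> [|u].
  by rewrite raddfB /= sX linearZ /= trmx_mul trmxK.
rewrite -/(qform _ _) -scaleNr qformD qformZ qform_outer vE' trmx_mul sX.
have := possemidef_CS u w pX; rewrite -/c.
set b := (_ 0 0) ^+ 2; set q := qform X u => bq.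
have q0 : 0 <= q := qX u.
rewrite mulNr subr_ge0 mulrC ler_pdivrMr ?ltr_wpDl//.
apply: (le_trans bq); nra.
Qed.

End QuadraticForms.

(** * Sparse matrices and the linear span of the cone *)

Section SparseSpan.
Variables (R : realType) (n : nat) (e : rel 'I_n).
Hypothesis e_sym : symmetric e.
Implicit Types (X Y : 'M[R]_n) (v : 'cV[R]_n).

Local Notation K := (sparse_cone R e).
Local Notation L := (linspan K).

(** The orthogonal projection onto the sparse symmetric matrices. It turns sparsity into a
    fixed-point equation of a linear map, from which stability under linear combinations and spans
    follows. *)
Definition sparse_proj X : 'M[R]_n :=
  \matrix_(i, j) if (i == j) || e i j then 2^-1 * (X i j + X j i) else 0.

Fact sparse_proj_is_linear : linear sparse_proj.
Proof.
move=> a X Y; apply/matrixP => i j; rewrite !mxE; case: ifP => _; last by ring.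
ring.
Qed.
HB.instance Definition _ :=
  GRing.isLinear.Build R 'M[R]_n 'M[R]_n _ sparse_proj sparse_proj_is_linear.

Lemma sparse_projP X : sparse e X <-> sparse_proj X = X.
Proof.
split=> [[sX zX]|pX].
  apply/matrixP => i j; rewrite mxE.
  have -> : X j i = X i j by rewrite -[in LHS]sX mxE.
  case: ifP => [_|/negbT]; first by field.
  by rewrite negb_or => /andP[ij eij]; rewrite zX.
split.
  apply/matrixP => i j; rewrite -pX !mxE eq_sym e_sym.
  by case: ifP => // _; rewrite addrC.
by move=> i j ij eij; rewrite -pX mxE (negbTE ij) (negbTE eij).
Qed.

Lemma sparse0 : sparse e (0 : 'M[R]_n).
Proof. by apply/sparse_projP; rewrite linear0. Qed.

Lemma sparseP a X Y : sparse e X -> sparse e Y -> sparse e (a *: X + Y).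
Proof.
by move=> /sparse_projP sX /sparse_projP sY; apply/sparse_projP; rewrite linearP /= sX sY.
Qed.

Lemma sparseD X Y : sparse e X -> sparse e Y -> sparse e (X + Y).
Proof. by move=> sX sY; rewrite -[X]scale1r; exact: sparseP. Qed.

Lemma sparseZ a X : sparse e X -> sparse e (a *: X).
Proof. by move=> sX; rewrite -[_ *: _]addr0; apply: sparseP => //; exact: sparse0. Qed.

Lemma sparse_delta i : sparse e (delta_mx i i : 'M[R]_n).
Proof.
split=> [|j k jk _]; first by rewrite trmx_delta.
rewrite mxE; apply/eqP; rewrite pnatr_eq0 eqb0; apply: contra jk.
by move=> /andP[/eqP-> /eqP->].
Qed.

Lemma sparse1 : sparse e (1%:M : 'M[R]_n).
Proof. by split=> [|i j ij _]; rewrite ?trmx1// mxE (negbTE ij). Qed.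

Lemma sparse_cone1 : K 1%:M.
Proof. by split; [exact: posdef1|exact: sparse1]. Qed.

Lemma closed_sparse_addeps (eps : R) X :
  0 < eps -> closed_sparse_cone R e X -> K (X + eps *: 1%:M).
Proof.
move=> e0 [pX sX]; split; first exact: possemidef_addeps.
by apply: sparseD => //; apply: sparseZ; exact: sparse1.
Qed.

Lemma closed_sparse_linspan X : closed_sparse_cone R e X -> X \in L.
Proof.
move=> cX; have KL := (linspanP K).1.
have -> : X = (X + 1 *: 1%:M) - 1%:M by rewrite scale1r addrK.
by rewrite rpredB// KL//; [exact: closed_sparse_addeps|exact: sparse_cone1].
Qed.

Lemma linspan_is_sparse X : X \in L -> sparse e X.
Proof.
have : (L <= lker (linfun sparse_proj - \1%VF)%R)%VS.
  apply: (linspanP K).2 => Y [_ /sparse_projP sY].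
  by rewrite memv_ker add_lfunE opp_lfunE id_lfunE lfunE /= sY subrr.
move=> /subvP LK /LK; rewrite memv_ker add_lfunE opp_lfunE id_lfunE lfunE /=.
by rewrite subr_eq0 => /eqP/sparse_projP.
Qed.

(* For k = l this is twice the matrix unit. *)
Definition symunit (k l : 'I_n) : 'M[R]_n := delta_mx k l + delta_mx l k.

(** Loops are added to the graph: these are the positions where an entry may be nonzero. *)
Definition adj (k l : 'I_n) := (k == l) || e k l.

Lemma adj_sym k l : adj k l = adj l k.
Proof. by rewrite /adj eq_sym e_sym. Qed.

Lemma symunitC k l : symunit k l = symunit l k.
Proof. by rewrite /symunit addrC. Qed.

Lemma delta_mem_linspan k : delta_mx k k \in L.
Proof.
apply: closed_sparse_linspan; split; last exact: sparse_delta.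
by rewrite delta_outer; exact: possemidef_outer.
Qed.

(** The matrix is the outer square of the sum of two coordinate vectors. It puts symmetric units
    into the span of the cone. *)
Lemma possemidef_symunit k l :
  possemidef (delta_mx k k + delta_mx l l + symunit k l : 'M[R]_n).
Proof.
pose v : 'cV[R]_n := delta_mx k 0 + delta_mx l 0.
suff -> : delta_mx k k + delta_mx l l + symunit k l = v *m v^T.
  exact: possemidef_outer.
rewrite /v [(_ + _)^T]linearD /= !trmx_delta mulmxDl !mulmxDr !mul_delta_mx.
by rewrite /symunit -!addrA; congr (_ + _); rewrite addrC -addrA.
Qed.

Lemma sparse_symunit k l : adj k l -> sparse e (symunit k l).
Proof.
move=> akl; split=> [|i j ij eij].
  by rewrite linearD /= !trmx_delta addrC.
have nE a b : adj a b -> (i == a) && (j == b) = false.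
  move=> ab; apply/negP => /andP[/eqP ia /eqP jb]; move: ab.
  by rewrite /adj -ia -jb (negbTE ij) (negbTE eij).
by rewrite !mxE !nE// ?addr0// adj_sym.
Qed.

Lemma symunit_mem_linspan k l : adj k l -> symunit k l \in L.
Proof.
move=> akl.
have -> : symunit k l =
    (delta_mx k k + delta_mx l l + symunit k l) - (delta_mx k k + delta_mx l l).
  by rewrite addrC addKr.
rewrite rpredB//; last by rewrite rpredD// delta_mem_linspan.
apply: closed_sparse_linspan; split; first exact: possemidef_symunit.
by apply: sparseD; [apply: sparseD; exact: sparse_delta|exact: sparse_symunit].
Qed.

(** The factor 1/2 accounts for each off-diagonal pair being met twice, and on the diagonal for
    [symunit k k] being twice a matrix unit. *)
Lemma sparse_symunitE X : sparse e X ->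
  X = \sum_k \sum_(l | adj k l) (X k l / 2) *: symunit k l.
Proof.
move=> [sX zX]; have X0 k l : ~~ adj k l -> X k l = 0.
  by rewrite negb_or => /andP[kl ekl]; exact: zX.
transitivity (\sum_k \sum_l (X k l / 2) *: symunit k l); last first.
  apply: eq_bigr => k _; rewrite [RHS]big_mkcond; apply: eq_bigr => l _.
  by case: ifP => // /negbT/X0 ->; rewrite mul0r scale0r.
under eq_bigr do under eq_bigr do rewrite scalerDr.
under eq_bigr do rewrite big_split.
rewrite big_split /= [X in _ + X]exchange_big /=.
have XE : X = \sum_k \sum_l X k l *: delta_mx k l := matrix_sum_delta X.
rewrite -big_split /= {1}XE; apply: eq_bigr => k _.
rewrite -big_split /=; apply: eq_bigr => l _.
have -> : X l k = X k l by rewrite -[in RHS]sX mxE.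
by rewrite -scalerDl; congr (_ *: _); field.
Qed.

Lemma linspan_sparseP X : X \in L <-> sparse e X.
Proof.
split=> [|sX]; first exact: linspan_is_sparse.
rewrite (sparse_symunitE sX) rpred_sum// => k _.
by rewrite rpred_sum// => l akl; rewrite rpredZ// symunit_mem_linspan.
Qed.

(** For every [eps > 0] the automorphism sends [x + eps 1] into the cone; letting [eps] tend to 0
    leaves a nonnegative form at [g x]. *)
Lemma aut_possemidef (g : 'End(subvs_of L)) (x : subvs_of L) :
  cone_aut (in_span K) g -> possemidef (vsval x) -> possemidef (vsval (g x)).
Proof.
move=> [_ gK] px.
have [sg _] : sparse e (vsval (g x)) by apply/linspan_sparseP; exact: subvsP.
split=> // u; rewrite -/(qform _ _).
have L1 : 1%:M \in L by apply/linspan_sparseP; exact: sparse1.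
pose one : subvs_of L := vsproj L 1%:M.
have oneE : vsval one = 1%:M by rewrite vsprojK.
have [->|u0] := eqVneq u 0; first by rewrite /qform mulmx0 mxE.
have gpos eps : 0 < eps -> 0 < qform (vsval (g x)) u + eps * qform (vsval (g one)) u.
  move=> e0; have : in_span K (x + eps *: one).
    rewrite /in_span /= oneE; apply: closed_sparse_addeps => //.
    by split=> //; apply/linspan_sparseP; exact: subvsP.
  move=> /(imageP g); rewrite gK => -[[_ /(_ _ u0)]].
  by rewrite -/(qform _ _) linearD linearZ /= qformD qformZ.
rewrite leNgt; apply/negP => q0.
set q := qform _ _ in q0 gpos; set q1 := qform _ _ in gpos.
(* Chosen so that [eps * q1 <= - q], which contradicts [gpos]; the [+ 1] covers [q1 = 0]. *)
pose eps := - q / (`|q1| + 1).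
have n1 : 0 < `|q1| + 1 by rewrite ltr_wpDl.
have e0 : 0 < eps by rewrite divr_gt0// oppr_gt0.
have := gpos _ e0; apply/negP; rewrite -leNgt.
have : eps * q1 <= - q.
  apply: (@le_trans _ _ (eps * (`|q1| + 1))).
    by rewrite ler_pM2l// (le_trans (ler_norm _))// lerDl.
  by rewrite /eps divfK// gt_eqF.
lra.
Qed.

End SparseSpan.

(** * Decomposition into sparse rank-one matrices *)

Section Decomposition.
Variables (R : realType) (n : nat) (e : rel 'I_n).
Hypothesis e_sym : symmetric e.
Implicit Types (X Y : 'M[R]_n) (v : 'cV[R]_n).

Local Notation K := (sparse_cone R e).
Local Notation L := (linspan K).

(** The support of [v] is a clique of the graph, which is what makes its outer square sparse. *)
Definition sparse_vec v : Prop :=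
  forall j k, j != k -> ~~ e j k -> v j 0 * v k 0 = 0.

Lemma outerE v j k : (v *m v^T) j k = v j 0 * v k 0.
Proof. by rewrite mxE big_ord1 mxE. Qed.

Lemma sparse_vecP v : sparse_vec v <-> closed_sparse_cone R e (v *m v^T).
Proof.
split=> [sv|[_ [_ zv]] j k jk ejk]; last by rewrite -outerE zv.
split; first exact: possemidef_outer.
split=> [|j k jk ejk]; first by rewrite trmx_mul trmxK.
by rewrite outerE sv.
Qed.

Lemma mulmx_tr_sum_col (V : 'M[R]_n) : V *m V^T = \sum_i col i V *m (col i V)^T.
Proof.
apply/matrixP => j k; rewrite summxE mxE; apply: eq_bigr => i _.
by rewrite outerE !mxE.
Qed.

Lemma sparse_cone_decomp X : homogeneous_cone K -> K X ->
  exists2 V : 'M[R]_n, V *m V^T = X & forall i, sparse_vec (col i V).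
Proof.
move=> [_ _ _ homK] KX.
have XL : X \in L := (linspanP K).1 _ KX.
have L1 : 1%:M \in L by apply/linspan_sparseP => //; exact: sparse1.
have [||g autg gX] := homK (vsproj L 1%:M) (vsproj L X).
- by rewrite /in_span /= vsprojK//; exact: sparse_cone1.
- by rewrite /in_span /= vsprojK.
have [kerg gK] := autg.
pose E i : subvs_of L := vsproj L (delta_mx i i).
have EE i : vsval (E i) = delta_mx i i by rewrite vsprojK// delta_mem_linspan.
pose B i := vsval (g (E i)).
have pB i : possemidef (B i).
  apply: aut_possemidef => //; rewrite EE delta_outer; exact: possemidef_outer.
have sB i : sparse e (B i) by apply/linspan_sparseP => //; exact: subvsP.
have XE : X = \sum_i B i.
  have -> : X = vsval (g (vsproj L 1%:M)) by rewrite gX vsprojK.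
  have -> : vsproj L 1%:M = \sum_i E i.
    apply: val_inj; rewrite /= vsprojK// linear_sum /=.
    under eq_bigr do rewrite EE.
    apply/matrixP => i j; rewrite summxE !mxE.
    under eq_bigr do rewrite mxE.
    rewrite (bigD1 i)//= eqxx /= big1 ?addr0; first by rewrite eq_sym.
    by move=> k; rewrite eq_sym => /negbTE ->.
  by rewrite !linear_sum.
have exu i : exists u : 'cV[R]_n, u != 0 /\ forall j, j != i -> B j *m u = 0.
  pose y := \sum_(j | j != i) E j.
  have gy : vsval (g y) = \sum_(j | j != i) B j by rewrite !linear_sum.
  have npd : ~ posdef (vsval (g y)).
    move=> pgy; have : in_span K (g y).
      by split=> //; apply/linspan_sparseP => //; exact: subvsP.
    rewrite -gK => -[z Kz /(lker0P (introT eqP kerg)) zy].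
    have [[_ pz] _] := Kz; have := pz (delta_mx i 0).
    rewrite zy linear_sum /= -/(qform _ _) qform_sum big1 ?ltxx.
      have u0 : delta_mx i 0 != 0 :> 'cV[R]_n.
        by apply/cV0Pn; exists i; rewrite mxE !eqxx oner_neq0.
      by move=> /(_ u0).
    move=> j ji; rewrite EE delta_outer qform_outer trmx_delta mul_delta_mx_cond.
    by rewrite (negbTE ji) mulr0n mxE expr0n.
  have pgy : possemidef (vsval (g y)).
    by rewrite gy; apply: possemidef_sum.
  have [u u0 qu] : exists2 u : 'cV[R]_n, u != 0 & qform (vsval (g y)) u = 0.
    apply: contrapT => nex; apply: npd; split=> [|u u0]; first by case: pgy.
    rewrite lt_neqAle; apply/andP; split; last by case: pgy => _; exact.
    by apply/eqP => q0; apply: nex; exists u.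
  exists u; split=> // j ji; apply: possemidef_ker => //.
  move: qu; rewrite gy qform_sum => /eqP.
  rewrite psumr_eq0; last by move=> k _; case: (pB k) => _; exact.
  by move=> /allP/(_ j (mem_index_enum j)); rewrite ji => /eqP.
have [u uP] := choice exu.
have Bu i j : j != i -> B j *m u i = 0 by move=> ji; case: (uP i) => _; exact.
pose U : 'M[R]_n := \matrix_(k, j) u j k 0.
have colU j : col j U = u j by apply/colP => k; rewrite !mxE.
pose c i := qform X (u i).
have c0 i : 0 < c i by case: KX => -[_ pX] _; apply: pX; case: (uP i).
(* [B i] kills every [u j] with [j != i], so in the family [u] its form has a single nonzero entry,
   which is also the form of [X] at [u i]. *)
have UBU i : U^T *m B i *m U = c i *: delta_mx i i.
  apply/matrixP => a b; transitivity (((u a)^T *m B i *m u b) 0 0).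
    rewrite -!colU !mxE; apply: eq_bigr => k _; rewrite !mxE; congr (_ * _).
    by apply: eq_bigr => l _; rewrite !mxE.
  rewrite [RHS]mxE [delta_mx _ _ _ _]mxE; have [ib|ib] := eqVneq i b; last first.
    rewrite -mulmxA Bu// mulmx0 mxE.
    by rewrite andbF mulr0.
  have [ia|ia] := eqVneq i a; last first.
    have -> : (u a)^T *m B i = 0.
      by apply: trmx_inj; rewrite trmx_mul trmxK (pB i).1 Bu ?trmx0.
    by rewrite mul0mx mxE mulr0.
  rewrite -ia -ib /= mulr1 /c XE qform_sum (bigD1 i)//= big1 ?addr0// => j ji.
  by rewrite /qform -mulmxA Bu ?mulmx0 ?mxE.
have UXU : U^T *m X *m U = diag_mx (\row_i c i).
  rewrite XE mulmx_sumr mulmx_suml; under eq_bigr do rewrite UBU.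
  apply/matrixP => a b; rewrite summxE mxE.
  under eq_bigr do rewrite !mxE.
  rewrite (bigD1 a)//= !eqxx /= big1 ?addr0.
    by rewrite mxE eq_sym; case: (a == b); rewrite ?mulr1 ?mulr0.
  by move=> k; rewrite eq_sym => /negbTE ->; rewrite mulr0.
(* The [u i] are independent because [U^T X U] is diagonal with positive entries. *)
have Uu : U \in unitmx.
  have : U^T *m X *m U \in unitmx.
    rewrite UXU unitmxE det_diag unitfE; apply/prodf_neq0 => i _.
    by rewrite mxE gt_eqF.
  by rewrite unitmx_mul => /andP[].
pose W := invmx U.
(* Undoing the congruence, [B i] is [c i] times the outer square of row [i] of [W]; the square root
   of [c i] is absorbed into column [i] of [V]. *)
pose V : 'M[R]_n := \matrix_(j, i) (W i j * Num.sqrt (c i)).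
have BV i : B i = col i V *m (col i V)^T.
  have -> : B i = W^T *m (c i *: delta_mx i i) *m W.
    rewrite -UBU /W -!mulmxA mulmxV// mulmx1 mulmxA -trmx_mul mulmxV//.
    by rewrite trmx1 mul1mx.
  apply/matrixP => j k; rewrite outerE !mxE.
  rewrite (bigD1 i)//= big1 ?addr0; last first.
    move=> a ai; rewrite mxE big1 ?mul0r// => b _.
    by rewrite !mxE eq_sym (negbTE ai) andbF !mulr0.
  rewrite mxE (bigD1 i)//= big1 ?addr0; last first.
    by move=> a ai; rewrite !mxE (negbTE ai) !mulr0.
  rewrite !mxE !eqxx mulr1 -[in LHS](sqr_sqrtr (ltW (c0 i))); ring.
exists V.
  by rewrite mulmx_tr_sum_col XE; apply: eq_bigr => i _; rewrite BV.
move=> i j k jk ejk; rewrite -outerE -BV; exact: (sB i).2.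
Qed.

End Decomposition.

(** * Closure of the cone, and decomposition of its boundary points *)

Section Closure.
Variables (R : realType) (n : nat) (e : rel 'I_n).
Hypothesis e_sym : symmetric e.
Implicit Types (X Y : 'M[R]_n) (v : 'cV[R]_n).

Local Notation K := (sparse_cone R e).

Lemma continuous_sumr (T : topologicalType) (I : Type) (r : seq I) (P : pred I)
    (F : I -> T -> R) :
  (forall i, continuous (F i)) -> continuous (fun x => \sum_(i <- r | P i) F i x).
Proof.
move=> cF x; elim: r => [|i r ih].
  by under eq_fun do rewrite big_nil; exact: cst_continuous.
under eq_fun do rewrite big_cons; case: (P i) => //.
by apply: cvgD => //; exact: cF.
Qed.

Lemma continuous_addr (T : topologicalType) (f g : T -> R) :
  continuous f -> continuous g -> continuous (fun x => f x + g x).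
Proof. by move=> cf cg x; apply: cvgD; [exact: cf|exact: cg]. Qed.

Lemma continuous_mulr (T : topologicalType) (f g : T -> R) :
  continuous f -> continuous g -> continuous (fun x => f x * g x).
Proof. by move=> cf cg x; apply: cvgM; [exact: cf|exact: cg]. Qed.

Lemma closure_ge0 (T : topologicalType) (A : set T) (f : T -> R) x :
  continuous f -> (forall y, A y -> 0 <= f y) -> closure A x -> 0 <= f x.
Proof.
move=> cf fA; have clf : closed (f @^-1` [set y | 0 <= y]).
  by move/continuous_closedP: cf; apply; exact: closed_ge.
move/closure_id: clf => clf clx.
suff : (f @^-1` [set y | 0 <= y]) x by [].
by rewrite clf; apply: closure_subset clx => y /fA.
Qed.

Lemma closure_eq0 (T : topologicalType) (A : set T) (f : T -> R) x :
  continuous f -> (forall y, A y -> f y = 0) -> closure A x -> f x = 0.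
Proof.
move=> cf fA clx; apply/eqP; rewrite eq_le -[_ <= 0]oppr_ge0.
rewrite (@closure_ge0 _ A f)// ?andbT; last by move=> y /fA ->.
apply: (@closure_ge0 _ A (fun y => - f y)) => // [y|y /fA ->]; last by rewrite oppr0.
by apply: cvgN; exact: cf.
Qed.

(** Symmetry, vanishing entries and nonnegativity of the form are closed conditions on continuous
    functions of the matrix. Conversely [X + eps 1] is in the cone and tends to [X]. *)
Lemma closure_sparse_cone : closure K = closed_sparse_cone R e.
Proof.
apply/seteqP; split=> X.
  (* One family of continuous functions serves twice: [s = -1] gives the symmetry of the limit,
     [s = 0] its zero entries. *)
  move=> clX; have entryD (s : R) i j k l :
      continuous (fun Y : 'M[R]_n => Y i j + s * Y k l).
    apply: continuous_addr; first exact: coord_continuous.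
    by apply: continuous_mulr; [exact: cst_continuous|exact: coord_continuous].
  have sX : X^T = X.
    apply/matrixP => i j; rewrite mxE; apply/eqP; rewrite -subr_eq0 -mulN1r.
    apply/eqP; apply: (@closure_eq0 _ K _ X (entryD (-1) j i i j)) => // Y.
    by move=> [[sY _] _]; rewrite -{2}sY mxE mulN1r subrr.
  split; split=> //; last first.
    move=> i j ij eij; have := @closure_eq0 _ K _ X (entryD 0 i j i j).
    by rewrite mul0r addr0; apply=> // Y [_ [_ zY]]; rewrite mul0r addr0 zY.
  move=> u; have qE Y : (u^T *m Y *m u) 0 0 = \sum_i \sum_j u j 0 * Y j i * u i 0.
    rewrite mxE; apply: eq_bigr => i _; rewrite mxE mulr_suml.
    by apply: eq_bigr => j _; rewrite mxE.
  rewrite qE; apply: (@closure_ge0 _ K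
      (fun Y => \sum_i \sum_j u j 0 * Y j i * u i 0) X) => //
      [|Y [/posdef_semidef[_ pY] _]].
    apply: continuous_sumr => i; apply: continuous_sumr => j.
    apply: continuous_mulr; last exact: cst_continuous.
    by apply: continuous_mulr; [exact: cst_continuous|exact: coord_continuous].
  by rewrite -qE.
move=> cX B /nbhs_ballP[d /= d0 dB].
exists (X + (d / 2) *: 1%:M); split.
  by apply: closed_sparse_addeps => //; rewrite divr_gt0.
apply: dB; split=> // i j; rewrite -ball_normE /= !mxE opprD addNKr.
rewrite normrN; case: (i == j); rewrite ?mulr1 ?mulr0 ?normr0//.
by rewrite gtr0_norm ?divr_gt0// ltr_pdivrMr// mulr2n mulrDr mulr1 ltrDl.
Qed.

(* Limit of the decompositions of X + eps 1: the sum of squares below is a    *)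
(* continuous function of V, attains its minimum on a compact set, and takes  *)
(* there the values n eps^2.                                                  *)
Lemma closed_sparse_decomp X : homogeneous_cone K -> closed_sparse_cone R e X ->
  exists2 V : 'M[R]_n, V *m V^T = X & forall i, sparse_vec e (col i V).
Proof.
move=> homK cX.
(* The candidate [V] is coded as a row vector of length [n * n]; [f j k] is the error of [V V^T] at
   entry [(j, k)], and [phi] the total squared error. *)
pose f j k (w : 'rV[R]_(n * n)) := (vec_mx w *m (vec_mx w)^T) j k - X j k.
pose phi w := \sum_j \sum_k f j k w * f j k w.
pose h i j k (w : 'rV[R]_(n * n)) := vec_mx w j i * vec_mx w k i.
(* A bound for the entries of [V] when [V V^T = X + eps 1] and [eps <= 1]: the square of an entry in
   row [j] is at most [X j j + 1], hence at most [c - 1], and [c >= 2]. *)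
pose c := \sum_i X i i + 2.
pose box : set 'rV[R]_(n * n) := [set w | forall l, `[- c, c]%classic (w ord0 l)].
pose Z : set 'rV[R]_(n * n) :=
  [set w | forall i j k, j != k -> ~~ e j k -> h i j k w = 0].
have cvec j i : continuous (fun w : 'rV[R]_(n * n) => vec_mx w j i).
  have -> : (fun w : 'rV[R]_(n * n) => vec_mx w j i) =
            (fun w : 'rV[R]_(n * n) => w 0 (mxvec_index j i)).
    by apply/funext => w; rewrite mxE.
  exact: coord_continuous.
have ch i j k : continuous (h i j k).
  by apply: continuous_mulr; exact: cvec.
have cf j k : continuous (f j k).
  have -> : f j k = (fun w => \sum_i h i j k w + - X j k).
    apply/funext => w; rewrite /f mxE; congr (_ + _).
    by apply: eq_bigr => i _; rewrite [_^T _ _]mxE.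
  apply: continuous_addr; last exact: cst_continuous.
  by apply: continuous_sumr => i; exact: ch.
have cphi : continuous phi.
  by apply: continuous_sumr => j; apply: continuous_sumr => k;
     apply: continuous_mulr; exact: cf.
have cpt : compact (box `&` Z).
  have boxc : compact box.
    exact: (@rV_compact R _ (fun=> `[- c, c]%classic) (fun=> @segment_compact R _ _)).
  apply: compact_closedI => //.
  move=> w clw i j k jk ejk; apply: (@closure_eq0 _ Z (h i j k)) => // y.
  exact.
have X0 i : 0 <= X i i.
  have := cX.1.2 (delta_mx i 0); rewrite trmx_delta -rowE -colE !mxE //.
have wP (eps : R) : 0 < eps <= 1 ->
    exists2 w, (box `&` Z) w & phi w = n%:R * (eps * eps).
  move=> /andP[e0 e1].
  have [V VX Vs] := sparse_cone_decomp e_sym homK (closed_sparse_addeps e_sym e0 cX).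
  exists (mxvec V); rewrite /phi /f /box /Z /h /=; last first.
    rewrite mxvecK VX; transitivity (\sum_(j < n) eps * eps).
      apply: eq_bigr => j _; rewrite (bigD1 j)//= big1 ?addr0.
        by rewrite !mxE eqxx mulr1; ring.
      by move=> k kj; rewrite !mxE eq_sym (negbTE kj) mulr0 addr0 subrr mulr0.
    by rewrite sumr_const card_ord mulr_natl.
  split=> [l|i j k jk ejk]; last by have := Vs i j k jk ejk; rewrite mxvecK !mxE.
  case/mxvec_indexP: l => j i; rewrite mxvecE /=.
  have VXj : \sum_k V j k ^+ 2 = X j j + eps.
    have := congr1 (fun M : 'M[R]_n => M j j) VX; rewrite !mxE eqxx mulr1 => <-.
    by apply: eq_bigr => k _; rewrite mxE.
  have Vji : V j i ^+ 2 <= X j j + eps.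
    by rewrite -VXj (bigD1 i)//= lerDl sumr_ge0// => k _; rewrite sqr_ge0.
  have Xc : X j j + 2 <= c.
    by rewrite /c lerD2r (bigD1 j)//= lerDl sumr_ge0.
  have := X0 j; rewrite in_itv /=; set a := V j i in Vji *.
  move=> Xj; apply/andP; split; nra.
have ne : (box `&` Z) !=set0.
  by have [|w ? _] := wP 1; [rewrite ltr01 lexx|exists w].
have [w /set_mem[bw Zw] wmin] := EVT_min_rV ne cpt (continuous_subspaceT cphi).
have phi0 : phi w <= 0.
  apply/ler_addgt0Pl => d d0; rewrite addr0.
  (* With [eps <= 1], the value [n eps^2] is at most [(n + 1) eps <= d]; using [n + 1] keeps the
     divisor positive also for [n = 0]. *)
  pose eps := Num.min 1 (d / n.+1%:R).
  have n0 : 0 < n.+1%:R :> R by rewrite ltr0n.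
  have e1 : eps <= 1 by rewrite ge_min lexx.
  have e0 : 0 < eps by rewrite lt_min ltr01 divr_gt0.
  have [|w' Sw' phiw'] := wP eps; first by rewrite e0.
  apply: (le_trans (wmin w' (mem_set Sw'))); rewrite phiw'.
  apply: (@le_trans _ _ (n.+1%:R * eps)).
    rewrite -natr1 mulrDl mul1r ler_wpDr ?(ltW e0)// ler_wpM2l//.
    by rewrite ler_piMl// ltW.
  have : eps <= d / n.+1%:R by rewrite ge_min lexx orbT.
  by rewrite ler_pdivlMr// mulrC.
have sq0 j k : 0 <= f j k w * f j k w by rewrite -expr2 sqr_ge0.
exists (vec_mx w); last by move=> i j k jk ejk; have := Zw i j k jk ejk; rewrite /h !mxE.
apply/matrixP => j k; apply/eqP; rewrite -subr_eq0 -/(f j k w).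
have : phi w == 0 by rewrite eq_le phi0; do 2!apply: sumr_ge0 => ? _.
rewrite psumr_eq0; last by move=> j' _; apply: sumr_ge0.
move=> /allP/(_ j (mem_index_enum j)) /=.
rewrite psumr_eq0// => /allP/(_ k (mem_index_enum k)) /=.
by rewrite -expr2 sqrf_eq0.
Qed.

End Closure.

(** * Faces *)

Lemma convex_setE (R : realType) (E : vectType R) (F : set E) :
  convex_set F <->
  forall (x y : E) (t : R), F x -> F y -> 0 <= t <= 1 -> F (t *: x + (1 - t) *: y).
Proof.
split=> [cF x y t Fx Fy /andP[t0 t1]|cF x y t /set_mem Fx /set_mem Fy].
  exact: set_mem (cF _ _ (Itv01 t0 t1) (mem_set Fx) (mem_set Fy)).
by apply: mem_set; apply: cF => //; apply/andP; split.
Qed.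

Section Faces.
Variables (R : realType) (n : nat) (e : rel 'I_n).
Hypothesis e_sym : symmetric e.
Implicit Types (X Y : 'M[R]_n) (v : 'cV[R]_n) (F : set 'M[R]_n).

Local Notation C := (closed_sparse_cone R e).

(** The consequence of homogeneity from which the facial structure is derived. *)
Hypothesis C_decomp : forall X, C X ->
  exists2 V : 'M[R]_n, V *m V^T = X & forall i, sparse_vec e (col i V).

Lemma closed_sparse0 : C 0.
Proof. by split; [exact: possemidef0|exact: sparse0]. Qed.

Lemma closed_sparseD X Y : C X -> C Y -> C (X + Y).
Proof. by move=> [? ?] [? ?]; split; [exact: possemidefD|exact: sparseD]. Qed.

Lemma closed_sparseZ (a : R) X : 0 <= a -> C X -> C (a *: X).
Proof. by move=> ? [? ?]; split; [exact: possemidefZ|exact: sparseZ]. Qed.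

(** On the kernel of [X + Y] two nonnegative forms add up to zero, so [X] vanishes there too;
    inclusion of kernels is inclusion of row spaces the other way round. *)
Lemma possemidef_sub_add X Y :
  possemidef X -> possemidef Y -> (X <= (X + Y)%R)%MS.
Proof.
move=> pX pY; rewrite submxE; apply/eqP/matrixP => i j.
pose u := cokermx (X + Y) *m delta_mx j 0 : 'cV[R]_n.
have : qform (X + Y) u = 0.
  have Zu : (X + Y) *m u = 0 by rewrite /u mulmxA mulmx_coker mul0mx.
  by rewrite /qform -mulmxA Zu mulmx0 mxE.
rewrite qformD => /eqP; rewrite paddr_eq0 ?pX.2 ?pY.2// => /andP[/eqP qX _].
have := possemidef_ker pX qX; rewrite mulmxA -colE => /colP/(_ i).
by rewrite !mxE.
Qed.

Lemma outer_sub v : (v^T <= v *m v^T)%MS.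
Proof.
have [->|/sqnorm_gt0 v0] := eqVneq v 0; first by rewrite trmx0 sub0mx.
have := mx11_scalar (v^T *m v); set c := (_ 0 0) in v0 * => vv.
apply/submxP; exists (c^-1 *: v^T).
by rewrite -scalemxAl mulmxA vv mul_scalar_mx scalerA mulVf ?scale1r ?gt_eqF.
Qed.

Lemma outer_eq0 v : (v *m v^T == 0) = (v == 0).
Proof.
apply/eqP/eqP => [v0|->]; last by rewrite mul0mx.
by apply: trmx_inj; apply/eqP; rewrite trmx0 -submx0 -v0 outer_sub.
Qed.

(** [V V^T] is the outer square of the column plus a semidefinite matrix. *)
Lemma col_sub_outer (V : 'M[R]_n) i : ((col i V)^T <= V *m V^T)%MS.
Proof.
apply: (submx_trans (outer_sub _)); rewrite mulmx_tr_sum_col (bigD1 i)//=.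
apply: possemidef_sub_add; first exact: possemidef_outer.
by apply: possemidef_sum => j _; exact: possemidef_outer.
Qed.

(** Every face will turn out to have this form. [W] may be rectangular, so that a single row [v^T]
    describes a ray. *)
Definition range_face m (W : 'M[R]_(m, n)) : set 'M[R]_n :=
  [set Y | C Y /\ (Y <= W)%MS].

Lemma range_faceP m (W : 'M[R]_(m, n)) : face C (range_face W).
Proof.
split.
- by exists 0; split; [exact: closed_sparse0|exact: sub0mx].
- by move=> X [].
- apply/convex_setE => X Y t [CX XW] [CY YW] /andP[t0 t1]; split.
    by apply: closed_sparseD; apply: closed_sparseZ => //; rewrite subr_ge0.
  by rewrite addmx_sub// scalemx_sub.
- move=> X Y t CX CY /andP[t0 t1] [_ XYW].
  have t1' : 0 < 1 - t by rewrite subr_gt0.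
  have pX : possemidef (t *: X) by apply: possemidefZ; [exact: ltW|case: CX].
  have pY : possemidef ((1 - t) *: Y) by apply: possemidefZ; [exact: ltW|case: CY].
  split; split=> //.
    rewrite -(eqmx_scale X (lt0r_neq0 t0)) (submx_trans _ XYW)//.
    exact: possemidef_sub_add.
  rewrite -(eqmx_scale Y (lt0r_neq0 t1')) (submx_trans _ XYW)// [X in (_ <= X)%MS]addrC.
  exact: possemidef_sub_add.
Qed.

Lemma range_face_subset X m (W : 'M[R]_(m, n)) : C X ->
  (range_face X `<=` range_face W) <-> (X <= W)%MS.
Proof.
move=> CX; split=> [XW|XW Y [CY YX]]; first by have [] := XW X (conj CX (submx_refl X)).
by split=> //; exact: submx_trans XW.
Qed.

(** [X] is the midpoint of [2 X] and 0, so the face contains 0. Multiples with [a <= 1] then follow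
    from convexity; for [a > 1], [X] lies on the open segment from [a X] to 0. *)
Lemma face_scale F (a : R) X : face C F -> 0 <= a -> F X -> F (a *: X).
Proof.
move=> [_ FC cF eF] a0 FX.
have F0 : F 0.
  have := eF (2 *: X) 0 2^-1; rewrite scalerA mulVf ?scale1r ?scaler0 ?addr0//.
  case=> //; first by apply: closed_sparseZ => //; exact: FC.
    exact: closed_sparse0.
  by apply/andP; split; lra.
have [a1|a1] := leP a 1.
  have /convex_setE/(_ X 0 a FX F0) := cF.
  by rewrite scaler0 addr0; apply; apply/andP.
have := eF (a *: X) 0 a^-1; rewrite scalerA mulVf ?scale1r ?scaler0 ?addr0; last first.
  by rewrite gt_eqF// (lt_trans ltr01).
case=> //; first by apply: closed_sparseZ => //; exact: FC.
  exact: closed_sparse0.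
by rewrite invr_gt0 invf_lt1 ?a1 ?andbT (lt_trans ltr01).
Qed.

Lemma face_add F X Y : face C F -> F X -> F Y -> F (X + Y).
Proof.
move=> fF FX FY; have [_ _ cF _] := fF.
have /convex_setE/(_ (2 *: X) (2 *: Y) 2^-1) := cF.
rewrite !scalerA (_ : 1 - 2^-1 = 2^-1); last by field.
by rewrite mulVf// !scale1r; apply; try exact: face_scale; apply/andP; split; lra.
Qed.

(** A small multiple of [v v^T] can be split off from [X] inside the closed cone, so that [X] lies
    on an open segment starting at [v v^T]. *)
Lemma face_outer F X v : face C F -> F X -> sparse_vec e v -> (v^T <= X)%MS ->
  F (v *m v^T).
Proof.
move=> fF FX sv vX; have [_ FC _ eF] := fF.
have [pX sX] := FC _ FX.
have [eps /andP[e0 e1] pXv] := possemidef_sub_outer pX vX.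
have [_ svv] := (sparse_vecP e v).1 sv.
have e1' : 0 < 1 - eps by rewrite subr_gt0.
have := eF (v *m v^T) ((1 - eps)^-1 *: (X - eps *: (v *m v^T))) eps.
rewrite scalerA mulfV ?gt_eqF// scale1r [eps *: _ + _]addrC subrK; case=> //.
- exact/sparse_vecP.
- apply: closed_sparseZ; first by rewrite invr_ge0 ltW.
  by split=> //; rewrite -scaleNr addrC; exact: sparseP.
- exact/andP.
Qed.

(** Take [X] of maximal rank in the face. Adding a member [Y] to it cannot enlarge the row space, so
    that of [Y] is contained in it. Conversely, a matrix of the closed cone with row space in that
    of [X] is a sum of sparse outer squares, each of which the face contains. *)
Lemma face_range F : face C F -> exists2 X, F X & F = range_face X.
Proof.
move=> fF; have [[X0 FX0] FC cF eF] := fF.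
pose P r := `[< exists2 X, F X & \rank X = r >].
have exP : exists r, P r by exists (\rank X0); apply/asboolP; exists X0.
have ubP r : P r -> (r <= n)%N by move=> /asboolP[X _ <-]; exact: rank_leq_row.
have [r /asboolP[X FX rX] rmax] := ex_maxnP exP ubP.
exists X => //; apply/seteqP; split=> Y.
  move=> FY; split; first exact: FC.
  have [pX _] := FC _ FX; have [pY _] := FC _ FY.
  apply: (@submx_trans _ _ _ _ _ _ (Y + X)); first exact: possemidef_sub_add.
  have XXY : (X <= (Y + X)%R)%MS by rewrite addrC possemidef_sub_add.
  rewrite -(geq_leqif (mxrank_leqif_sup XXY)) rX; apply: rmax.
  by apply/asboolP; exists (Y + X) => //; exact: face_add.
move=> [CY YX]; have [V VY Vs] := C_decomp CY.
rewrite -VY mulmx_tr_sum_col; elim/big_ind: _ => [|A B FA FB|i _].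
- by rewrite -(scale0r X); exact: face_scale.
- exact: face_add.
apply: (face_outer fF FX) => //; apply: submx_trans YX.
by rewrite -VY col_sub_outer.
Qed.

(** * Extreme rays and the Caratheodory number *)

Lemma range_face_vec v Y : range_face v^T Y -> exists a, Y = a *: (v *m v^T).
Proof.
move=> [CY Yv]; have [V VY _] := C_decomp CY.
have exa i : exists a, col i V = a *: v.
  have /sub_rVP[a aP] : ((col i V)^T <= v^T)%MS.
    by apply: submx_trans Yv; rewrite -VY col_sub_outer.
  by exists a; rewrite -[LHS]trmxK aP linearZ /= trmxK.
have [a aP] := choice exa; exists (\sum_i a i * a i).
rewrite -VY mulmx_tr_sum_col scaler_suml; apply: eq_bigr => i _.
by rewrite aP linearZ /= -scalemxAl -scalemxAr scalerA.
Qed.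

Lemma extreme_ray_vec v : sparse_vec e v -> v != 0 ->
  extreme_ray C (range_face v^T).
Proof.
move=> /sparse_vecP Cv v0; split; first exact: range_faceP.
suff -> : linspan (range_face v^T) = <[v *m v^T]>%VS by rewrite dim_vline outer_eq0 v0.
have [sub min] := linspanP (range_face v^T).
apply/eqP; rewrite eqEsubv; apply/andP; split.
  by apply: min => Y /range_face_vec[a ->]; rewrite memvZ// memv_line.
by rewrite -memvE; apply: sub; split=> //; exact: submxMl.
Qed.

(** The face contains a nonzero outer square from the decomposition of [Y], which already spans its
    one-dimensional span. *)
Lemma extreme_ray_rank F Y : extreme_ray C F -> F Y -> (\rank Y <= 1)%N.
Proof.
move=> [fF dimF] FY; have [_ FC _ _] := fF.
have [V VY Vs] := C_decomp (FC _ FY).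
have [->|Y0] := eqVneq Y 0; first by rewrite mxrank0.
have [i vi] : exists i, col i V != 0.
  apply/existsP; apply: contraR Y0; rewrite negb_exists => /forallP v0.
  rewrite -VY mulmx_tr_sum_col big1// => i _.
  by move: (v0 i); rewrite negbK => /eqP ->; rewrite mul0mx.
set v := col i V in vi; have [sub _] := linspanP F.
have Fv : F (v *m v^T).
  by apply: (face_outer fF FY); [exact: Vs|rewrite -VY; exact: col_sub_outer].
have : <[v *m v^T]>%VS == linspan F.
  by rewrite eqEdim -memvE sub//= dimF dim_vline outer_eq0 vi.
move=> /eqP Fvv; have := sub _ FY; rewrite -Fvv => /vlineP[a ->].
by rewrite (leq_trans (mxrankS (scalemx_sub _ (submxMl _ _))))// rank_leq_row.
Qed.

Lemma sparse_vec_delta i : sparse_vec e (delta_mx i 0 : 'cV[R]_n).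
Proof.
by apply/sparse_vecP; rewrite -delta_outer; split;
  [rewrite delta_outer; exact: possemidef_outer|exact: sparse_delta].
Qed.

Lemma closed_sparse1 : C 1%:M.
Proof. by split; [apply: posdef_semidef; exact: posdef1|exact: sparse1]. Qed.

Lemma delta_neq0 i : delta_mx i 0 != 0 :> 'cV[R]_n.
Proof. by apply/cV0Pn; exists i; rewrite mxE !eqxx oner_neq0. Qed.

Lemma sum_of_rays_order X : C X -> sum_of_rays C X n.
Proof.
move=> CX; have [V VX Vs] := C_decomp CX.
(* A zero column gives no ray; the ray of a coordinate vector takes its place and contributes the
   zero matrix. *)
pose w i := if col i V == 0 then delta_mx i 0 else col i V.
exists (fun i => range_face (w i)^T), (fun i => col i V *m (col i V)^T); split.
- move=> i; rewrite /w; case: ifPn => [_|v0].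
    by apply: extreme_ray_vec; [exact: sparse_vec_delta|exact: delta_neq0].
  exact: extreme_ray_vec.
- move=> i; split; first exact/sparse_vecP.
  rewrite /w; case: ifPn => [/eqP ->|_]; first by rewrite mul0mx sub0mx.
  exact: submxMl.
- by rewrite -VX mulmx_tr_sum_col.
Qed.

(** Rank is subadditive and at most one on extreme rays. Applied to the identity, this is the lower
    bound for the Caratheodory number. *)
Lemma rank_sum_of_rays X m : sum_of_rays C X m -> (\rank X <= m)%N.
Proof.
move=> [F [y [rF Fy ->]]]; apply: (@leq_trans (\sum_(i < m) 1)%N); last first.
  by rewrite sum1_card card_ord.
elim/big_ind2: _ => [|A a B b Aa Bb|i _]; first by rewrite mxrank0.
  by rewrite (leq_trans (mxrank_add _ _))// leq_add.
exact: extreme_ray_rank (rF i) (Fy i).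
Qed.

Lemma caratheodory_order : caratheodory_number_eq C n.
Proof.
split.
  exists 1%:M; first exact: closed_sparse1.
  split; first by apply: sum_of_rays_order; exact: closed_sparse1.
  by move=> m /rank_sum_of_rays; rewrite mxrank1.
move=> X CX; pose P k := `[< sum_of_rays C X k >].
have exP : exists k, P k by exists n; apply/asboolP; exact: sum_of_rays_order.
have [k /asboolP Xk kmin] := ex_minnP exP; exists k.
  by split=> // m Xm; apply: kmin; apply/asboolP.
by apply: kmin; apply/asboolP; exact: sum_of_rays_order.
Qed.

(** * Maximal chains of faces *)

Lemma range_face_nonzero X : C X -> X != 0 -> nonzero_face C (range_face X).
Proof.
move=> CX X0; split; first exact: range_faceP.
move=> XE; have : range_face X X by split.
by rewrite XE /= => /eqP; rewrite (negbTE X0).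
Qed.

Lemma nonzero_face_range F : nonzero_face C F ->
  exists X, [/\ C X, X != 0 & F = range_face X].
Proof.
move=> [fF F0]; have [X FX FE] := face_range fF; exists X; split=> //.
  by have [_ FC _ _] := fF; exact: FC.
apply/eqP => X0; apply: F0; rewrite FE X0; apply/seteqP; split=> Y.
  by move=> [_]; rewrite submx0 => /eqP.
by move=> ->; split; [exact: closed_sparse0|exact: sub0mx].
Qed.

Lemma closed_sparse_pid r : (r <= n)%N -> C (pid_mx r).
Proof.
move=> rn; suff -> : pid_mx r = \sum_(i < n | (i < r)%N) delta_mx i i :> 'M[R]_n.
  elim/big_ind: _ => [||i _]; [exact: closed_sparse0|exact: closed_sparseD|].
  by rewrite delta_outer; apply/sparse_vecP; exact: sparse_vec_delta.
apply/matrixP => i j; rewrite summxE !mxE.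
under eq_bigr do rewrite mxE.
rewrite big_mkcond (bigD1 i)//= big1 ?addr0; last first.
  by move=> k; rewrite eq_sym => /negbTE ->; case: ifP.
by rewrite eqxx /= eq_sym andbC; case: (i < r)%N => //=; rewrite andbF.
Qed.

(** The coordinate flag, with ranks n, ..., 1. A nonzero face comparable with all its members equals
    the one of its own rank, since nested faces of equal rank coincide. *)
Lemma maximal_chain_exists :
  exists F : 'I_n -> set 'M[R]_n, maximal_face_chain C F.
Proof.
have Cpid r : (r <= n)%N -> C (pid_mx r) by exact: closed_sparse_pid.
have rk r : (r <= n)%N -> \rank (pid_mx r : 'M[R]_n) = r.
  by move=> rn; rewrite rank_pid_mx.
exists (fun i => range_face (pid_mx (n - i)%N : 'M[R]_n)); split; first split.
- move=> i; apply: range_face_nonzero; first by apply: Cpid; exact: leq_subr.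
  by rewrite -mxrank_eq0 rk ?leq_subr// subn_eq0 -ltnNge.
- move=> i j ij; split.
    apply/range_face_subset; first by apply: Cpid; exact: leq_subr.
    apply/submxP; exists (pid_mx (n - j)%N).
    rewrite mul_pid_mx; congr pid_mx; rewrite (minn_idPl (leq_sub2l n (ltnW ij))).
    by rewrite (minn_idPr (leq_subr _ _)).
  move=> /range_face_subset => /(_ (Cpid _ (leq_subr _ _))) /mxrankS.
  by rewrite !rk ?leq_subr// leqNgt ltn_sub2l// (ltn_trans ij).
move=> F' /nonzero_face_range[X [CX X0 ->]] cmp.
have r0 : (0 < \rank X)%N by rewrite lt0n mxrank_eq0.
have rn : (\rank X <= n)%N := rank_leq_row X.
(* The member of index [i] has rank [n - i], so the one of the rank of [X] has index
   [n - \rank X]. *)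
have ri : (n - \rank X < n)%N by rewrite ltn_subrL r0 (leq_trans r0).
exists (Ordinal ri); have := cmp (Ordinal ri); rewrite /= subKn//.
set Z := pid_mx _ => cmpZ.
have rZ : \rank Z = \rank X by rewrite rk.
have CZ : C Z by exact: Cpid.
have both (A B : 'M[R]_n) : C A -> C B -> \rank A = \rank B -> (A <= B)%MS ->
    range_face A = range_face B.
  move=> CA CB rAB AB; apply/seteqP; split; apply/range_face_subset => //.
  by rewrite -(geq_leqif (mxrank_leqif_sup AB)) rAB.
case: cmpZ => /range_face_subset; first by move=> /(_ CX); exact: both.
by move=> /(_ CZ) ZX; apply/esym; exact: both.
Qed.

(* Adding to a face of rank r a rank-one matrix outside of it generates a     *)
(* face of rank r + 1, so a maximal chain meets every rank.                   *)
Lemma maximal_chain_length l (F : 'I_l -> set 'M[R]_n) :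
  maximal_face_chain C F -> l = n.
Proof.
move=> [[nzF decF] maxF].
have [X XP] := choice (fun i => nonzero_face_range (nzF i)).
have CX i : C (X i) by case: (XP i).
have FE i : F i = range_face (X i) by case: (XP i).
pose r (i : 'I_l) : nat := \rank (X i).
have r_dec (i j : 'I_l) : (i < j)%N -> (r j < r i)%N.
  move=> /decF[sub nsub]; rewrite /r.
  have ji : (X j <= X i)%MS.
    by apply/range_face_subset => //; rewrite -!FE.
  rewrite ltn_neqAle mxrankS// andbT; apply/eqP => rij; apply: nsub.
  rewrite !FE; apply/range_face_subset => //.
  by rewrite -(geq_leqif (mxrank_leqif_sup ji)) rij.
have r_le i j : (r i <= r j)%N -> (X i <= X j)%MS.
  move=> rij; apply/range_face_subset => //; rewrite -!FE.
  have [ij|ji|/ord_inj -> //] := ltngtP i j.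
    by move: rij; rewrite leqNgt r_dec.
  by have [] := decF _ _ ji.
have r_inj : injective r.
  move=> i j rij; apply/ord_inj; have [/r_dec|/r_dec|//] := ltngtP i j.
    by rewrite rij ltnn.
  by rewrite rij ltnn.
have r_gt0 i : (0 < r i)%N by rewrite lt0n mxrank_eq0; case: (XP i).
have r_len i : (r i <= n)%N := rank_leq_row (X i).
have r_onto k : (0 < k <= n)%N -> exists i, r i = k.
  move=> /andP[k0 kn]; apply: contrapT => nk.
  have rk i : r i != k by apply/eqP => rik; apply: nk; exists i.
  (* If rank [k] is missed, [A] gives the largest face of the chain of rank below [k], with 0 as
     default, and [B] below the smallest one of rank above [k], with the identity as default. *)
  have [A [CA rA Amax AE]] : exists A, [/\ C A, (\rank A < k)%N,
      forall i, (r i < k)%N -> (X i <= A)%MS &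
      A = 0 \/ exists2 i, (r i < k)%N & A = X i].
    have [/existsP[i0 i0k]|] := boolP [exists i, r i < k]%N; last first.
      rewrite negb_exists => /forallP none.
      exists 0; split; [exact: closed_sparse0|by rewrite mxrank0| |by left].
      by move=> i; rewrite (negbTE (none i)).
    case: (@arg_maxnP _ i0 (fun i => r i < k)%N r i0k) => i ik imax.
    exists (X i); split=> // [j /imax|]; first exact: r_le.
    by right; exists i.
  have [B [CB rB Bmin BE]] : exists B, [/\ C B, (k <= \rank B)%N,
      forall i, (k < r i)%N -> (B <= X i)%MS &
      B = 1%:M \/ exists2 i, (k < r i)%N & B = X i].
    have [/existsP[i0 i0k]|] := boolP [exists i, k < r i]%N; last first.
      rewrite negb_exists => /forallP none.
      exists 1%:M; split; [exact: closed_sparse1|by rewrite mxrank1| |by left].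
      by move=> i; rewrite (negbTE (none i)).
    case: (@arg_minnP _ i0 (fun i => k < r i)%N r i0k) => i ik imin.
    exists (X i); split=> // [|j /imin|]; [exact: ltnW|exact: r_le|].
    by right; exists i.
  have AB : (A <= B)%MS.
    case: AE => [->|[i ik ->]]; first exact: sub0mx.
    case: BE => [->|[j kj ->]]; first exact: submx1.
    by apply: r_le; rewrite ltnW// (ltn_trans ik).
  have [V VB Vs] := C_decomp CB.
  (* The rank of [A] is below that of [B], so some outer square in the decomposition of [B] is not
     captured by [A]. *)
  have [i0 vA] : exists i, ~~ ((col i V)^T <= A)%MS.
    apply/existsP; apply: contraLR rB; rewrite negb_exists -ltnNge => /forallP VA.
    apply: leq_ltn_trans rA; apply: mxrankS; rewrite -VB mulmx_tr_sum_col.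
    apply: summx_sub => i _; rewrite (submx_trans (submxMl _ _))//.
    by have := VA i; rewrite negbK.
  set v := col i0 V in vA; pose Z := A + v *m v^T.
  have pA : possemidef A by case: CA.
  have CZ : C Z by apply: closed_sparseD => //; apply/sparse_vecP; exact: Vs.
  have AZ : (A <= Z)%MS by apply: possemidef_sub_add => //; exact: possemidef_outer.
  have vZ : (v^T <= Z)%MS.
    rewrite (submx_trans (outer_sub v))// /Z addrC.
    by apply: possemidef_sub_add => //; exact: possemidef_outer.
  have ZB : (Z <= B)%MS.
    by rewrite addmx_sub// (submx_trans (submxMl _ _))// -VB col_sub_outer.
  have rZ : (\rank Z <= k)%N.
    apply: (leq_trans (mxrank_add _ _)); apply: leq_trans rA.
    rewrite -[X in (_ <= X)%N]addn1 leq_add2l.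
    by rewrite (leq_trans (mxrankS (submxMl _ _)))// rank_leq_row.
  have Z0 : Z != 0.
    by apply: contraNneq vA => Z0; move: vZ; rewrite Z0 => /submx_trans;
      apply; exact: sub0mx.
  (* The face of [Z] is comparable with the whole chain, hence belongs to it. Its rank is at most
     [k] and differs from [k], so its row space lies in that of [A], although [v^T] does not. *)
  have [i0' | i iE] := maxF _ (range_face_nonzero CZ Z0).
    rewrite FE; have [ik|ki|ik] := ltngtP (r i0') k.
    - by right; apply/range_face_subset => //; exact: submx_trans (Amax _ ik) AZ.
    - by left; apply/range_face_subset => //; exact: submx_trans ZB (Bmin _ ki).
    - by have := rk i0'; rewrite ik eqxx.
  have ZX : (Z <= X i)%MS by apply/range_face_subset => //; rewrite iE FE.
  have XZ : (X i <= Z)%MS by apply/range_face_subset => //; rewrite iE FE.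
  have ik : (r i < k)%N.
    by rewrite ltn_neqAle rk (leq_trans (mxrankS XZ)).
  have := submx_trans vZ (submx_trans ZX (Amax _ ik)).
  by rewrite (negbTE vA).
(* The ranks along the chain enumerate 1, ..., n without repetition. *)
have : perm_eq [seq r i | i <- enum 'I_l] (iota 1 n).
  apply: uniq_perm; [by rewrite map_inj_uniq ?enum_uniq|exact: iota_uniq|].
  move=> k; rewrite mem_iota add1n ltnS; apply/mapP/idP => [[i _ ->]|/r_onto[i <-]].
    by rewrite r_gt0 r_len.
  by exists i; rewrite ?mem_enum.
by move=> /perm_size; rewrite size_map size_iota size_enum_ord.
Qed.

End Faces.

(** * Multiplier endomorphisms and their coordinates *)

Section Coordinates.
Variables (R : realType) (E : vectType R).
Import VectorInternalTheory.

Lemma lfun_f2mx (g : 'End(E)) x : g x = r2v (v2r x *m f2mx g).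
Proof. by rewrite unlock. Qed.

Lemma f2mx_entry (g : 'End(E)) i j : f2mx g i j = v2r (g (r2v (delta_mx 0 i))) 0 j.
Proof. by rewrite lfun_f2mx !r2vK -rowE mxE. Qed.

(** The weights do not depend on [g]: continuity and derivatives of the matrix entries of [g] pass
    to every linear coordinate of [g x]. *)
Lemma lform_f2mx (f : {linear E -> R^o}) (x : E) :
  exists w : 'I_(dim E) -> 'I_(dim E) -> R,
    forall g : 'End(E), f (g x) = \sum_k \sum_l f2mx g k l * w k l.
Proof.
exists (fun k l => v2r x 0 k * f (r2v (delta_mx 0 l))) => g.
rewrite lfun_f2mx [v2r x *m _]row_sum_delta !linear_sum /= exchange_big /=.
apply: eq_bigr => l _; rewrite !linearZ /= [X in X *: _]mxE scaler_suml.
by apply: eq_bigr => k _; rewrite /GRing.scale /=; ring.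
Qed.

Lemma basis_of_span (s : seq E) :
  exists2 b : seq E, {subset b <= s} & basis_of << s >> b.
Proof.
elim: s => [|v s [b bs bb]]; first by exists [::]; rewrite // span_nil nil_basis.
have [vs|vs] := boolP (v \in << s >>%VS).
  exists b; first by move=> x /bs xs; rewrite inE xs orbT.
  by rewrite span_cons (addv_idPr _)// -memvE.
exists (v :: b).
  by move=> x; rewrite !inE => /orP[->//|/bs ->]; rewrite orbT.
by rewrite /basis_of free_cons (basis_free bb) !span_cons (span_basis bb) vs eqxx.
Qed.

Lemma continuous_matrix (T : topologicalType) m p (f : T -> 'M[R]_(m, p)) :
  (forall i j, continuous (fun x => f x i j)) -> continuous f.
Proof.
move=> cf x B [P PB sub]; rewrite /= nbhs_filterE.
have : \forall y \near x, forall i j, P i j (f y i j).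
  by apply: filter_forall => i; apply: filter_forall => j; exact: cf (PB i j).
by apply: filterS => y; exact: sub.
Qed.

Lemma is_derive_sumr m (f : 'I_m -> R -> R) (df : 'I_m -> R) (x : R) :
  (forall i, is_derive x 1 (f i) (df i)) ->
  is_derive x 1 (fun t => \sum_i f i t) (\sum_i df i).
Proof.
move=> fd; have -> : (fun t => \sum_i f i t) = \sum_i f i.
  by apply/funext => t; rewrite fct_sumE.
exact: is_derive_sum.
Qed.

Lemma is_derive_mulrc (f : R -> R) (df x c : R) :
  is_derive x 1 f df -> is_derive x 1 (fun t => f t * c) (df * c).
Proof.
move=> fd; have -> : (fun t => f t * c) = c \*: f.
  by apply/funext => t /=; rewrite /GRing.scale /= mulrC.
by apply: is_derive_eq; rewrite /GRing.scale /= mulrC.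
Qed.

Lemma is_derive_uniq (f : R -> R) (x a b : R) :
  is_derive x 1 f a -> is_derive x 1 f b -> a = b.
Proof.
move=> fa fb; rewrite -(@derive_val _ _ _ _ _ _ _ fa).
exact: (@derive_val _ _ _ _ _ _ _ fb).
Qed.

End Coordinates.

(** * Entrywise multipliers and diagonal congruences on the span of the cone *)

Section Multipliers.
Variables (R : realType) (n : nat) (e : rel 'I_n).
Hypothesis e_sym : symmetric e.
Import VectorInternalTheory.

Local Notation K := (sparse_cone R e).
Local Notation L := (linspan K).
Local Notation S := (subvs_of L).
Implicit Types (x y : S) (c : 'M[R]_n) (d : 'I_n -> R).

(** The projection makes this an endomorphism of the span for every [c]; for symmetric [c] the
    entrywise product is already in the span. *)
Definition hadamard c x : S := vsproj L (\matrix_(i, j) (c i j * vsval x i j)).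

Fact hadamard_is_linear c : linear (hadamard c).
Proof.
move=> a x y; rewrite /hadamard -linearP; congr (vsproj _ _).
by apply/matrixP => i j; rewrite !mxE mulrDr mulrCA.
Qed.
HB.instance Definition _ c :=
  GRing.isLinear.Build R S S _ (hadamard c) (hadamard_is_linear c).

Definition mult c : 'End(S) := linfun (hadamard c).

Fact mult_is_linear : linear mult.
Proof.
move=> a c c'; apply/lfunP => x.
rewrite add_lfunE scale_lfunE !lfunE /= /hadamard -linearP; congr (vsproj _ _).
by apply/matrixP => i j; rewrite !mxE mulrDl mulrA.
Qed.
HB.instance Definition _ :=
  GRing.isLinear.Build R 'M[R]_n 'End(S) _ mult mult_is_linear.

Lemma span_sparse x : sparse e (vsval x).
Proof. by apply/linspan_sparseP => //; exact: subvsP. Qed.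

Lemma span_sym x i j : vsval x i j = vsval x j i.
Proof. by have [sx _] := span_sparse x; rewrite -[in LHS]sx mxE. Qed.

Lemma multE c x i j : c^T = c -> vsval (mult c x) i j = c i j * vsval x i j.
Proof.
move=> sc; rewrite lfunE /= /hadamard vsprojK ?mxE//.
apply/linspan_sparseP => //; split=> [|k l kl ekl].
  by apply/matrixP => k l; rewrite !mxE span_sym -[in LHS]sc mxE.
by rewrite mxE (span_sparse x).2 ?mulr0.
Qed.

Lemma end_ext (f g : 'End(S)) :
  (forall x i j, vsval (f x) i j = vsval (g x) i j) -> f = g.
Proof.
by move=> fg; apply/lfunP => x; apply: val_inj; apply/matrixP => i j; exact: fg.
Qed.

Definition sv k l : S := vsproj L (symunit R k l).

Lemma svE k l : adj e k l -> vsval (sv k l) = symunit R k l.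
Proof. by move=> akl; rewrite vsprojK// symunit_mem_linspan. Qed.

Definition sv1 : S := vsproj L 1%:M.

Lemma sv1E : vsval sv1 = 1%:M.
Proof. by rewrite vsprojK//; apply/linspan_sparseP => //; exact: sparse1. Qed.

Lemma span_svE x : x = \sum_k \sum_(l | adj e k l) (vsval x k l / 2) *: sv k l.
Proof.
apply: val_inj; rewrite /= [LHS](sparse_symunitE (span_sparse x)) linear_sum.
apply: eq_bigr => k _; rewrite linear_sum; apply: eq_bigr => l akl.
by rewrite linearZ /= svE.
Qed.

(** The congruence [X |-> D X D], where [D] is the diagonal matrix of [d]. *)
Definition torus_elt d : 'End(S) := mult (\matrix_(i, j) (d i * d j)).

Lemma torus_eltE d x i j : vsval (torus_elt d x) i j = d i * d j * vsval x i j.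
Proof.
by rewrite multE ?mxE//; apply/matrixP => k l; rewrite !mxE mulrC.
Qed.

Definition diag_torus : set 'End(S) :=
  [set g | exists2 d, (forall i, 0 < d i) & g = torus_elt d].

Lemma torus_elt1 : torus_elt (fun=> 1) = \1%VF.
Proof. by apply: end_ext => x i j; rewrite torus_eltE id_lfunE !mul1r. Qed.

Lemma torus_eltM d d' :
  (torus_elt d \o torus_elt d')%VF = torus_elt (fun i => d i * d' i).
Proof. by apply: end_ext => x i j; rewrite comp_lfunE !torus_eltE; ring. Qed.

Lemma torus_eltVK d : (forall i, 0 < d i) ->
  (torus_elt d \o torus_elt (fun i => (d i)^-1%R) = \1)%VF.
Proof.
move=> d0; rewrite torus_eltM -torus_elt1; congr torus_elt; apply/funext => i.
by rewrite mulfV ?gt_eqF.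
Qed.

Lemma torus_eltKV d : (forall i, 0 < d i) ->
  (torus_elt (fun i => (d i)^-1%R) \o torus_elt d = \1)%VF.
Proof.
move=> d0; rewrite torus_eltM -torus_elt1; congr torus_elt; apply/funext => i.
by rewrite mulVf ?gt_eqF.
Qed.

Lemma lker_torus_elt d : (forall i, 0 < d i) -> lker (torus_elt d) = 0%VS.
Proof.
move=> d0; apply/eqP/lker0P => x y xy.
by rewrite -[x]id_lfunE -[y]id_lfunE -(torus_eltKV d0) !comp_lfunE xy.
Qed.

Lemma torus_elt_cone d x : (forall i, 0 < d i) ->
  in_span K x -> in_span K (torus_elt d x).
Proof.
move=> d0 [[sx px] _]; split; last exact: span_sparse.
split=> [|u u0]; first by case: (span_sparse (torus_elt d x)).
pose w : 'cV[R]_n := \col_i (d i * u i 0).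
have -> : (u^T *m vsval (torus_elt d x) *m u) 0 0 = (w^T *m vsval x *m w) 0 0.
  rewrite !mxE; apply: eq_bigr => i _; rewrite !mxE !mulr_suml.
  by apply: eq_bigr => j _; rewrite torus_eltE !mxE; ring.
apply: px; have /cV0Pn[i ui] := u0; apply/cV0Pn; exists i.
by rewrite mxE mulf_neq0// gt_eqF.
Qed.

Lemma torus_elt_aut d : (forall i, 0 < d i) -> cone_aut (in_span K) (torus_elt d).
Proof.
move=> d0; split; first exact: lker_torus_elt.
apply/seteqP; split=> [_ [x Kx <-]|x Kx]; first exact: torus_elt_cone.
exists (torus_elt (fun i => (d i)^-1) x).
  by apply: torus_elt_cone => // i; rewrite invr_gt0.
by rewrite -comp_lfunE torus_eltVK// id_lfunE.
Qed.

Lemma torus_elt_inv d : (forall i, 0 < d i) ->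
  ((torus_elt d)^-1)%VF = torus_elt (fun i => (d i)^-1).
Proof.
move=> d0; rewrite -[LHS]comp_lfun1r -(torus_eltVK d0).
by rewrite lker0_compKf// lker_torus_elt.
Qed.

(** The coordinates of [mult c] are linear in [c], so paths of multipliers are as continuous or
    differentiable as their entries. *)
Lemma mult_f2mx i j : exists w : 'I_n -> 'I_n -> R, forall c,
  f2mx (mult c) i j = \sum_k \sum_l c k l * w k l.
Proof.
exists (fun k l => f2mx (mult (delta_mx k l)) i j) => c.
have cE : mult c = \sum_k \sum_l c k l *: mult (delta_mx k l).
  rewrite {1}[c]matrix_sum_delta linear_sum; apply: eq_bigr => k _.
  by rewrite linear_sum; apply: eq_bigr => l _; rewrite linearZ.
rewrite f2mx_entry cE sum_lfunE linear_sum summxE.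
apply: eq_bigr => k _; rewrite sum_lfunE linear_sum summxE.
apply: eq_bigr => l _.
by rewrite scale_lfunE linearZ mxE -f2mx_entry.
Qed.

Lemma entry_f2mx x i j : exists w, forall g : 'End(S),
  vsval (g x) i j = \sum_k \sum_l f2mx g k l * w k l.
Proof.
pose f (y : S) : R^o := vsval y i j.
have lf : linear f by move=> a y z; rewrite /f linearP !mxE.
pose F : {linear S -> R^o} := HB.pack f (GRing.isLinear.Build R S R^o _ f lf).
by have [w wP] := lform_f2mx F x; exists w => g; rewrite -wP.
Qed.

Lemma torus_elt_sv d k l : adj e k l ->
  torus_elt d (sv k l) = (d k * d l) *: sv k l.
Proof.
move=> akl; apply: val_inj; apply/matrixP => i j.
rewrite torus_eltE /= svE// !mxE.
have dE p q : d i * d j * ((i == p) && (j == q))%:R =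
    d p * d q * ((i == p) && (j == q))%:R.
  by case: andP => [[/eqP-> /eqP->]//|_]; rewrite !mulr0.
by rewrite !mulrDr !dE [d l * d k]mulrC.
Qed.

(** The symmetric units are eigenvectors and span; as [(k, l)] and [(l, k)] give the same one, a
    basis is extracted from them. *)
Lemma torus_real_semisimple d : real_semisimple (torus_elt d).
Proof.
pose s := [seq sv p.1 p.2 | p <- enum {: 'I_n * 'I_n} & adj e p.1 p.2].
have [b bs bb] := basis_of_span s.
exists b.
  suff <- : << s >>%VS = fullv by [].
  apply/eqP; rewrite eqEsubv subvf /=; apply/subvP => x _.
  rewrite (span_svE x) rpred_sum// => k _; rewrite rpred_sum// => l akl.
  rewrite rpredZ// memv_span//; apply/mapP; exists (k, l) => //.
  by rewrite mem_filter akl mem_enum.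
move=> v /bs/mapP[[k l]]; rewrite mem_filter /= => /andP[akl _] ->.
by exists (d k * d l); exact: torus_elt_sv.
Qed.

End Multipliers.
Arguments mult {R n} e c.
Arguments sv R {n} e k l.
Arguments sv1 R {n} e.
Arguments torus_elt {R n} e d.
Arguments diag_torus R {n} e.

(** * The torus of positive diagonal congruences *)

(** The power of 2 on each side counts how often [m] occurs in the pair, so equality for all [m]
    identifies the unordered pairs. *)
Lemma weight_pair (R : realType) (I : eqType) (i j k l : I) :
  (forall m, (if i == m then 2 else 1) * (if j == m then 2 else 1) =
    (if k == m then 2 else 1) * (if l == m then 2 else 1) :> R) ->
  (i = k /\ j = l) \/ (i = l /\ j = k).
Proof.
move=> mE; have := mE i; have := mE j; have := mE k; have := mE l; rewrite !eqxx.
have [ij|_] := eqVneq i j; have [ik|_] := eqVneq i k;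
have [il|_] := eqVneq i l; have [jk|_] := eqVneq j k;
have [jl|_] := eqVneq j l; have [kl|_] := eqVneq k l => /= E1 E2 E3 E4;
first [by left | by right | exfalso; move: E1 E2 E3 E4; clear; lra].
Qed.

Section Torus.
Variables (R : realType) (n : nat) (e : rel 'I_n).
Hypothesis e_sym : symmetric e.
Import VectorInternalTheory.

Local Notation K := (sparse_cone R e).
Local Notation L := (linspan K).
Local Notation S := (subvs_of L).
Implicit Types (x y : S) (c : 'M[R]_n) (d : 'I_n -> R) (h : 'End(S)).

Local Notation T := (diag_torus R e).

(** The torus is a union of paths through the identity: positive vectors are joined to the all-ones
    vector by segments of positive vectors. *)
Lemma connected_diag_torus : connected_group T.
Proof.
pose path d (t : R) : 'M[R]_(dim S) := f2mx (torus_elt e (fun i => 1 - t + t * d i)).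
have cpath d : continuous (path d).
  apply: continuous_matrix => i j; have [w wP] := mult_f2mx i j.
  have -> : (fun t => path d t i j) = (fun t => \sum_k \sum_l
      ((1 - t + t * d k) * (1 - t + t * d l)) * w k l).
    apply/funext => t; rewrite /path wP.
    by apply: eq_bigr => k _; apply: eq_bigr => l _; rewrite mxE.
  have cd (k : 'I_n) : continuous (fun t : R => 1 - t + t * d k).
    move=> t; apply: cvgD.
      by apply: cvgB; [exact: cvg_cst|exact: cvg_id].
    by apply: cvgM; [exact: cvg_id|exact: cvg_cst].
  apply: continuous_sumr => k; apply: continuous_sumr => l.
  by apply: continuous_mulr; [apply: continuous_mulr|exact: cst_continuous].
pose P := [set d : 'I_n -> R | forall i, 0 < d i].
rewrite /connected_group.
have -> : [set f2mx g | g in T] = \bigcup_(d in P) (path d @` `[0, 1]%classic).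
  apply/seteqP; split=> [_ [_ [d d0 ->] <-]|_ [d d0 [t t01 <-]]].
    exists d => //; exists 1; first by rewrite /= in_itv /= ler01 lexx.
    by rewrite /path; congr (f2mx (torus_elt _ _)); apply/funext => i; ring.
  exists (torus_elt e (fun i => 1 - t + t * d i)) => //.
  exists (fun i => 1 - t + t * d i) => // i.
  move: t01; rewrite /= in_itv /= => /andP[t0 t1]; have := d0 i.
  have [->|t0'] := eqVneq t 0; first by rewrite mul0r subr0 addr0.
  have tpos : 0 < t by rewrite lt_neqAle eq_sym t0'.
  by move=> di; rewrite ltr_wpDl ?subr_ge0 ?mulr_gt0.
apply: bigcup_connected.
  exists (f2mx \1%VF) => d d0; exists 0; first by rewrite /= in_itv /= lexx ler01.
  rewrite /path -torus_elt1//; congr (f2mx (torus_elt _ _)).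
  by apply/funext => i; ring.
move=> d _; apply: connected_continuous_connected.
  by apply/connected_intervalP; exact: interval_is_interval.
exact: continuous_subspaceT.
Qed.

Lemma split_diag_torus : split_torus (in_span K) T.
Proof.
split.
- by move=> _ [d d0 ->]; exact: torus_elt_aut.
- split.
  + by exists (fun=> 1) => //; rewrite torus_elt1.
  + move=> _ _ [d d0 ->] [d' d'0 ->]; exists (fun i => d i * d' i).
      by move=> i; rewrite mulr_gt0.
    by rewrite torus_eltM.
  + move=> _ [d d0 ->]; exists (fun i => (d i)^-1); last by rewrite torus_elt_inv.
    by move=> i; rewrite invr_gt0.
- move=> _ _ [d d0 ->] [d' d'0 ->]; rewrite !torus_eltM//; congr torus_elt.
  by apply/funext => i; rewrite mulrC.
- exact: connected_diag_torus.
- by move=> _ [d d0 ->]; exact: torus_real_semisimple.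
Qed.

(** * The Lie algebra of the torus and its dimension *)

Definition torus_lie (a : 'rV[R]_n) : 'End(S) :=
  mult e (\matrix_(i, j) (a 0 i + a 0 j)).

Fact torus_lie_is_linear : linear torus_lie.
Proof.
move=> s a b; rewrite /torus_lie -linearP; congr mult.
by apply/matrixP => i j; rewrite !mxE; ring.
Qed.
HB.instance Definition _ :=
  GRing.isLinear.Build R 'rV[R]_n 'End(S) _ torus_lie torus_lie_is_linear.

Lemma torus_lieE a x i j : vsval (torus_lie a x) i j = (a 0 i + a 0 j) * vsval x i j.
Proof.
by rewrite multE// ?mxE//; apply/matrixP => k l; rewrite !mxE addrC.
Qed.

(** With [A] the diagonal matrix of [a], [torus_lie a] is [X |-> A X + X A], the derivative at 0 of
    the congruences by [exp(tA)]. *)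
Lemma lie_diag_torus_sub a : lie_algebra T (torus_lie a).
Proof.
exists (fun t => torus_elt e (fun i => expR (t * a 0 i))); split.
- by move=> t; exists (fun i => expR (t * a 0 i)) => // i; exact: expR_gt0.
- rewrite -torus_elt1//; congr torus_elt; apply/funext => i.
  by rewrite mul0r expR0.
- move=> s t; rewrite torus_eltM//; congr torus_elt; apply/funext => i.
  by rewrite mulrDl expRD.
move=> i j; have [w wP] := mult_f2mx i j.
rewrite wP; have -> : (fun t => f2mx (torus_elt e (fun i0 => expR (t * a 0 i0))) i j) =
    (fun t => \sum_k \sum_l expR (t * (a 0 k + a 0 l)) * w k l).
  apply/funext => t; rewrite wP; apply: eq_bigr => k _; apply: eq_bigr => l _.
  by rewrite mxE -expRD -mulrDr.
apply: is_derive_sumr => k; apply: is_derive_sumr => l.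
apply: is_derive_mulrc; rewrite mxE; set s := (_ + _).
have ds : is_derive (0 : R) 1 (fun t : R => t * s) (1 * s).
  by apply: is_derive_mulrc; exact: is_derive_id.
have de : is_derive (0 * s) 1 (@expR R) (expR (0 * s)) by exact: is_derive_expR.
apply: (is_derive_eq (@is_derive1_comp R expR (fun t => t * s) 0 _ _ de ds)).
by rewrite mul0r expR0 !mul1r.
Qed.

(** The vectors [d t] are merely chosen, and only the entries [d_i d_j x_ij] are known to be
    differentiable. Squaring such an entry expresses it through [d_i^2] and [d_j^2], the diagonal
    entries of the image of the identity, and comparing derivatives at 0 determines [X]. *)
Lemma lie_diag_torusE X : lie_algebra T X -> exists a, X = torus_lie a.
Proof.
move=> [phi [phiT phi0 phiD dphi]].
have exd t : exists d, (forall i, 0 < d i) /\ phi t = torus_elt e d.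
  by have [d d0 ->] := phiT t; exists d.
have [d dP] := choice exd.
have dE x i j :
    is_derive (0 : R) 1 (fun t => d t i * d t j * vsval x i j) (vsval (X x) i j).
  have [w wP] := entry_f2mx x i j; rewrite wP.
  have -> : (fun t => d t i * d t j * vsval x i j) =
      (fun t => \sum_k \sum_l f2mx (phi t) k l * w k l).
    by apply/funext => t; rewrite -wP (dP t).2 torus_eltE.
  by apply: is_derive_sumr => k; apply: is_derive_sumr => l; apply: is_derive_mulrc.
(* [torus_lie a] sends the identity to a matrix with diagonal [2 a]. *)
exists (\row_i (vsval (X (sv1 R e)) i i / 2)).
apply: end_ext => // x i j; rewrite torus_lieE !mxE -mulrDl.
have d1 k : is_derive (0 : R) 1 (fun t => d t k * d t k) (vsval (X (sv1 R e)) k k).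
  have := dE (sv1 R e) k k; rewrite sv1E// mxE eqxx.
  by under eq_fun do rewrite mulr1.
have d0 x' k l : d 0 k * d 0 l * vsval x' k l = vsval x' k l.
  by rewrite -torus_eltE// -(dP 0).2 phi0 id_lfunE.
have d0k k : d 0 k * d 0 k = 1.
  by have := d0 (sv1 R e) k k; rewrite sv1E// mxE eqxx mulr1.
have [x0|x0] := eqVneq (vsval x i j) 0.
  rewrite x0 mulr0; have := dE x i j; rewrite x0; under eq_fun do rewrite mulr0.
  by move=> /is_derive_uniq; apply; exact: is_derive_cst.
set b := vsval (X x) i j; set bi := vsval (X (sv1 R e)) i i;
  set bj := vsval (X (sv1 R e)) j j.
pose f t := d t i * d t j * vsval x i j.
have f0 : f 0 = vsval x i j by rewrite /f d0.
have df : is_derive (0 : R) 1 f b := dE x i j.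
have d2 : is_derive (0 : R) 1 (f * f) (f 0 *: b + f 0 *: b) by exact: is_deriveM.
have d2' := is_derive_mulrc (vsval x i j * vsval x i j) (is_deriveM (d1 i) (d1 j)).
have : f 0 *: b + f 0 *: b =
    ((d 0 i * d 0 i) *: bj + (d 0 j * d 0 j) *: bi) * (vsval x i j * vsval x i j).
  apply: is_derive_uniq d2 _; have -> : (f * f) = (fun t =>
     ((fun t => d t i * d t i) * (fun t => d t j * d t j)) t *
     (vsval x i j * vsval x i j)).
    by apply/funext => t; rewrite !mulrfctE /f; ring.
  exact: d2'.
rewrite !d0k f0 !scale1r /GRing.scale /= => h.
apply: (mulfI (x := 2 * vsval x i j)); first by rewrite mulf_neq0// pnatr_eq0.
transitivity ((bj + bi) * (vsval x i j * vsval x i j)); last by field.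
by rewrite -h; ring.
Qed.

(** The Lie algebra is the image of the n-dimensional row space under [torus_lie], which is
    injective because the image of the identity has diagonal [2 a]. *)
Lemma group_dim_diag_torus : group_dim T n.
Proof.
exists (limg (linfun torus_lie)).
  move=> X; split.
    move=> /memv_imgP[a _ ->]; rewrite lfunE; exact: lie_diag_torus_sub.
  move=> /lie_diag_torusE[a ->]; apply/memv_imgP; exists a; first exact: memvf.
  by rewrite lfunE.
rewrite limg_dim_eq; first by rewrite dimvf /dim /= mul1n.
apply/eqP; rewrite -subv0; apply/subvP => a /memv_capP[_].
rewrite memv_ker lfunE memv0 => /eqP a0; apply/eqP/rowP => i; rewrite mxE.
have := torus_lieE a (sv1 R e) i i; rewrite a0 zero_lfunE sv1E// !mxE eqxx mulr1.
by move=> /esym/eqP; rewrite -mulr2n mulrn_eq0 /= => /eqP.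
Qed.

(** * Maximality of the torus *)

Lemma symunit_sym (k l i j : 'I_n) : symunit R k l i j = symunit R k l j i.
Proof. by rewrite !mxE addrC andbC [(j == l) && _]andbC. Qed.

Lemma symunit_gt0 (k l : 'I_n) : 0 < symunit R k l k l.
Proof. by rewrite !mxE !eqxx ltr_wpDr. Qed.

(** [symunit k l] has weight [d_k d_l] under the torus, distinct unordered pairs have distinct
    weights, and [h] preserves weight spaces; so each symmetric unit is an eigenvector of [h]. *)
Lemma commuting_mult h : (forall g, T g -> (g \o h = h \o g)%VF) ->
  exists2 c, c^T = c & h = mult e c.
Proof.
move=> hT.
have weight k l i j : adj e k l -> vsval (h (sv R e k l)) i j != 0 ->
    (i = k /\ j = l) \/ (i = l /\ j = k).
  move=> akl nz.
  have dE d : (forall m, 0 < d m) -> d i * d j = d k * d l.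
    move=> d0; apply: (mulIf nz); rewrite -torus_eltE// -comp_lfunE hT; last by exists d.
    rewrite comp_lfunE (_ : torus_elt e d _ = (d k * d l) *: sv R e k l).
      by rewrite linearZ /= mxE.
    exact: torus_elt_sv.
  (* Vectors that are 2 at one coordinate and 1 elsewhere suffice to separate the weights. *)
  have d2E (m : 'I_n) := dE (fun m' => if m' == m then 2 else 1).
  have {}d2E (m : 'I_n) : (if i == m then 2 else 1) * (if j == m then 2 else 1) =
      (if k == m then 2 else 1) * (if l == m then 2 else 1) :> R.
    by apply: (d2E m) => m'; case: ifP.
  exact: weight_pair d2E.
(* The eigenvalues; the divisor is 2 on the diagonal and 1 elsewhere. *)
pose c := \matrix_(k, l) (vsval (h (sv R e k l)) k l / symunit R k l k l).
have svC k l : sv R e k l = sv R e l k by rewrite /sv symunitC.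
have sc : c^T = c.
  apply/matrixP => k l; rewrite mxE [c l k]mxE [c k l]mxE svC span_sym//.
  by rewrite symunitC symunit_sym.
exists c => //.
have hsv k l : adj e k l -> vsval (h (sv R e k l)) = c k l *: symunit R k l.
  move=> akl; apply/matrixP => i j.
  have kk : vsval (h (sv R e k l)) k l = c k l * symunit R k l k l.
    by rewrite mxE divfK// gt_eqF// symunit_gt0.
  rewrite [RHS]mxE; have [z|nz] := eqVneq (vsval (h (sv R e k l)) i j) 0; last first.
    have [[-> ->//]|[-> ->]] := weight _ _ _ _ akl nz.
    by rewrite span_sym// kk symunit_sym.
  rewrite z; have [iE|iN] := boolP ((i == k) && (j == l)).
    by move: iE z => /andP[/eqP-> /eqP->] <-.
  have [iE|iN'] := boolP ((i == l) && (j == k)).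
    move: iE z => /andP[/eqP-> /eqP->]; rewrite span_sym// kk => <-.
    by rewrite symunit_sym.
  by rewrite !mxE (negbTE iN) (negbTE iN') addr0 mulr0.
apply: end_ext => // x i j; congr (fun M : 'M[R]_n => M i j).
have -> : h x = \sum_k \sum_(l | adj e k l) (vsval x k l / 2) *: h (sv R e k l).
  rewrite {1}(span_svE e_sym x) linear_sum; apply: eq_bigr => k _.
  by rewrite linear_sum; apply: eq_bigr => l _; rewrite linearZ.
rewrite [RHS](sparse_symunitE (span_sparse e_sym (mult e c x))).
rewrite linear_sum; apply: eq_bigr => k _.
rewrite linear_sum; apply: eq_bigr => l akl.
by rewrite linearZ /= hsv// scalerA multE// mulrAC [c k l * _]mulrC.
Qed.

(** The image of the identity is positive definite with diagonal entries [c i i]. The outer square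
    of the sum of two coordinate vectors has a semidefinite image, whose 2 by 2 minor gives the
    inequality. *)
Lemma mult_cone_aut c : c^T = c -> cone_aut (in_span K) (mult e c) ->
  (forall i, 0 < c i i) /\ (forall k l, e k l -> k != l -> c k l ^+ 2 <= c k k * c l l).
Proof.
move=> sc autc; have [_ cK] := autc; split=> [i|k l ekl kl].
  have : in_span K (mult e c (sv1 R e)).
    by rewrite -cK; apply: imageP; rewrite /in_span /= sv1E//; exact: sparse_cone1.
  move=> [[_ /(_ _ (delta_neq0 R i)) pos] _]; move: pos.
  by rewrite trmx_delta -rowE -colE !mxE multE// sv1E// mxE eqxx mulr1.
have akl : adj e k l by rewrite /adj ekl orbT.
pose A : 'M[R]_n := delta_mx k k + delta_mx l l + symunit R k l.
have AL : A \in L.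
  by rewrite rpredD ?symunit_mem_linspan// rpredD ?delta_mem_linspan.
have pA : possemidef (vsval (mult e c (vsproj L A))).
  apply: aut_possemidef => //; rewrite vsprojK//.
  exact: possemidef_symunit.
have AE i j : vsval (mult e c (vsproj L A)) i j = c i j * A i j.
  by rewrite multE// vsprojK.
have := possemidef_CS (delta_mx l 0) (delta_mx k 0) pA; rewrite /qform !trmx_delta.
rewrite -!rowE -!colE; do !rewrite [col _ _ _ _]mxE [row _ _ _ _]mxE.
rewrite !AE !mxE !eqxx (negbTE kl) [l == k]eq_sym (negbTE kl) /=.
by rewrite !(addr0, add0r, mulr1).
Qed.

Lemma maximal_diag_torus : maximal_split_torus (in_span K) T.
Proof.
split; first exact: split_diag_torus.
move=> H [Haut [H1 HM HV] Hcomm Hconn _] TH; apply/seteqP; split=> // h Hh.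
have Hmult g : H g -> exists2 c, c^T = c & g = mult e c.
  by move=> Hg; apply: commuting_mult => t /TH Ht; exact: Hcomm.
(* The inverse of [g] is also a multiplier, so the two multipliers have product 1 at [(k, l)]. *)
have Hne k l g : adj e k l -> H g -> vsval (g (sv R e k l)) k l != 0.
  move=> akl Hg; have [c sc cE] := Hmult g Hg; have [c' sc' cE'] := Hmult _ (HV g Hg).
  have kerg : lker g == 0%VS by apply/eqP; case: (Haut _ Hg).
  apply/eqP => z; have := congr1 (fun f : 'End(S) => vsval (f (sv R e k l)) k l)
    (lker0_compVf kerg).
  rewrite /= comp_lfunE id_lfunE cE' multE// z mulr0 svE// => /eqP.
  by rewrite eq_sym gt_eqF// symunit_gt0.
(* The entry is a continuous function on the connected group [H], never zero, and positive at the
   identity. *)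
have Hpos k l : adj e k l -> 0 < vsval (h (sv R e k l)) k l.
  move=> akl; have [w wP] := entry_f2mx (sv R e k l) k l.
  pose psi (M : 'M[R]_(dim S)) := \sum_a \sum_b M a b * w a b.
  have cpsi : continuous psi.
    apply: continuous_sumr => a; apply: continuous_sumr => b.
    by apply: continuous_mulr; [exact: coord_continuous|exact: cst_continuous].
  have psiE g : psi (f2mx g) = vsval (g (sv R e k l)) k l by rewrite wP.
  have /connected_intervalP itv :=
    connected_continuous_connected Hconn (continuous_subspaceT cpsi).
  have in1 : (psi @` [set f2mx g | g in H]) (psi (f2mx \1%VF)).
    by apply: imageP; apply: imageP.
  have inh : (psi @` [set f2mx g | g in H]) (psi (f2mx h)).
    by apply: imageP; apply: imageP.
  rewrite ltNge; apply/negP => hneg.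
  have : (psi @` [set f2mx g | g in H]) 0.
    by apply: (itv _ _ inh in1); rewrite !psiE hneg id_lfunE svE// ltW// symunit_gt0.
  move=> [_ [g Hg <-]]; rewrite psiE => /eqP; exact/negP/Hne.
have [c sc hE] := Hmult h Hh; have [c' sc' hE'] := Hmult _ (HV h Hh).
have := mult_cone_aut sc; rewrite -hE => /(_ (Haut _ Hh))[c0 ccs].
have := mult_cone_aut sc'; rewrite -hE' => /(_ (Haut _ (HV _ Hh)))[c'0 c'cs].
have kerh : lker h == 0%VS by apply/eqP; case: (Haut _ Hh).
have svkl k l : adj e k l -> vsval (sv R e k l) k l != 0.
  by move=> akl; rewrite svE// gt_eqF// symunit_gt0.
have cc' k l : adj e k l -> c' k l * c k l = 1.
  move=> akl; have := congr1 (fun f : 'End(S) => vsval (f (sv R e k l)) k l)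
    (lker0_compVf kerh).
  rewrite /= comp_lfunE id_lfunE hE' multE// {1}hE multE// mulrA => cs.
  by apply: (mulIf (svkl k l akl)); rewrite mul1r.
have cpos k l : adj e k l -> 0 < c k l.
  move=> akl; have := Hpos k l akl; rewrite hE multE// pmulr_lgt0//.
  by rewrite svE// symunit_gt0.
(* On the diagonal [d_i^2 = c i i] leaves no other positive choice. *)
exists (fun i => Num.sqrt (c i i)); first by move=> i; rewrite sqrtr_gt0.
rewrite hE; apply: end_ext => // x i j; rewrite multE// torus_eltE//.
have [aij|] := boolP (adj e i j); last first.
  rewrite negb_or => /andP[ij eij].
  by rewrite (span_sparse e_sym x).2// !mulr0.
congr (_ * _); have [<-|ij] := eqVneq i j; first by rewrite -expr2 sqr_sqrtr// ltW.
have eij : e i j by move: aij; rewrite /adj (negbTE ij).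
have cle := ccs _ _ eij ij; have c'le := c'cs _ _ eij ij.
have arefl k : adj e k k by rewrite /adj eqxx.
have cii := cc' _ _ (arefl i); have cjj := cc' _ _ (arefl j); have cij := cc' _ _ aij.
(* The inverse of [h] has the inverse entries as multiplier, so its minor inequality is the reverse
   of [cle]. *)
have cge : c i i * c j j <= c i j ^+ 2.
  have c'E k l : adj e k l -> c' k l = (c k l)^-1.
    move=> akl; have ckl := lt0r_neq0 (cpos _ _ akl).
    by apply: (mulIf ckl); rewrite cc'// mulVf.
  move: c'le; rewrite !c'E// -invfM exprVn lef_pV2// posrE ?exprn_gt0 ?mulr_gt0 ?cpos//.
rewrite -sqrtrM ?ltW//; have -> : c i i * c j j = c i j ^+ 2.
  by apply/eqP; rewrite eq_le cge cle.
by rewrite sqrtr_sqr gtr0_norm// cpos.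
Qed.

End Torus.

Theorem theorem5p4 (R : realType) (n : nat) (e : rel 'I_n)
    (e_sym : symmetric e) (e_irr : irreflexive e) :
  homogeneous_cone (sparse_cone R e) ->
  [/\ torus_rank_eq (sparse_cone R e) n,
      chain_rank_eq (sparse_cone R e) n,
      closure (sparse_cone R e) = closed_sparse_cone R e &
      caratheodory_number_eq (closed_sparse_cone R e) n].
Proof.
move=> homK.
have decomp X := @closed_sparse_decomp R n e e_sym X homK.
split.
- exists (diag_torus R e); first exact: maximal_diag_torus.
  exact: group_dim_diag_torus.
- rewrite /chain_rank_eq closure_sparse_cone//; split.
    exact: maximal_chain_exists.
  by move=> l F; exact: maximal_chain_length.
- exact: closure_sparse_cone.
- exact: caratheodory_order.
Qed.
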